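(* Let $D$ be an integral domain, $K$ a field containing $D$ as a subring, and $\mathcal{X}$ a model of $K$ over $D$. Then $(\mathcal{X},\mathcal{O}_{\mathcal{X}})$ is a quasi-compact, quasi-separated, integral scheme.
   Context: Rings are commutative with identity; nothing is assumed Noetherian. $\mathcal{L}(K/D)$ is the set of local domains $R$ with $D\subseteq R\subseteq K$ and fraction field $K$. For an integral domain $A$, $\mathcal{S}(A)=\{A_P : P\text{ a prime ideal of }A\}$ (subrings of the fraction field of $A$). A local domain $(S,M_S)$ dominates $(R,M_R)$ if $R$ is a subring of $S$ and $M_R=M_S\cap R$. A premodel of $K$ over $D$ is a nonempty subset of $\mathcal{L}(K/D)$. It is irredundant if no two distinct elements are dominated by the same valuation ring of $K$ (equivalently, by the same local domain). An affine ring over $D$ is a subring of $K$ containing $D$ that is finitely generated as a $D$-algebra. A model of $K$ over $D$ is an irredundant premodel of the form $\bigcup_{\epsilon\in\Lambda}\mathcal{S}(D_\epsilon)$ for a finite family $\{D_\epsilon\}_{\epsilon\in\Lambda}$ of affine rings over $D$. The Zariski topology on $\mathcal{X}$ has as basis the sets $\{R\in\mathcal{X}:R\supseteq H\}$, $H\subseteq K$ finite. $\mathcal{O}_{\mathcal{X}}$ is defined by $\mathcal{O}_{\mathcal{X}}(U)=\bigcap_{R\in U}R$ for nonempty open $U$ (zero ring for $U=\emptyset$), with inclusions as restriction maps (or the zero map when the target is the zero ring). Quasi-separated means that the intersection of two quasi-compact open sets is quasi-compact. *)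

(* Defs.v *)
(* Schemes as locally ringed spaces, and the space of local rings attached to  *)
(* a model of a field in the sense of Zariski.                               *)
From HB Require Import structures.
From mathcomp Require Import all_boot all_order all_algebra generic_quotient.
From mathcomp Require Import ring.
From mathcomp Require Import all_classical topology.

Set Implicit Arguments.
Unset Strict Implicit.
Unset Printing Implicit Defensive.

Import GRing.Theory.
Local Open Scope classical_set_scope.
Local Open Scope ring_scope.
Local Open Scope quotient_scope.

Section Ideals.
Variable R : comPzRingType.

(* Ideals of a subring [A] of [R]; [A := setT] gives the ideals of [R].       *)
Definition ideal (A I : set R) : Prop :=
  [/\ I `<=` A, I 0, forall x y, I x -> I y -> I (x + y)
    & forall a x, A a -> I x -> I (a * x)].

Definition prime_ideal (A P : set R) : Prop :=
  [/\ ideal A P, ~ P 1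
    & forall x y, A x -> A y -> P (x * y) -> P x \/ P y].

Definition maximal_ideal (A M : set R) : Prop :=
  [/\ ideal A M, ~ M 1
    & forall J, ideal A J -> ~ J 1 -> M `<=` J -> J = M].

Definition local (A : set R) : Prop := exists! M, maximal_ideal A M.

End Ideals.

Definition domain (R : comPzRingType) : Prop :=
  (1 : R) <> 0 /\ forall x y : R, x * y = 0 -> x = 0 \/ y = 0.

(* A commutative ring up to an equivalence relation, and its quotient ring;   *)
(* used for localizations and stalks.                                         *)
Record setoid_ring := SetoidRing {
  sr_elt :> choiceType;
  sr_eqv : sr_elt -> sr_elt -> Prop;
  sr_zero : sr_elt;
  sr_one : sr_elt;
  sr_opp : sr_elt -> sr_elt;
  sr_add : sr_elt -> sr_elt -> sr_elt;
  sr_mul : sr_elt -> sr_elt -> sr_elt;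
  sr_refl : forall x, sr_eqv x x;
  sr_sym : forall x y, sr_eqv x y -> sr_eqv y x;
  sr_trans : forall x y z, sr_eqv x y -> sr_eqv y z -> sr_eqv x z;
  sr_opp_eqv : forall x y, sr_eqv x y -> sr_eqv (sr_opp x) (sr_opp y);
  sr_add_eqv : forall x x' y y',
    sr_eqv x x' -> sr_eqv y y' -> sr_eqv (sr_add x y) (sr_add x' y');
  sr_mul_eqv : forall x x' y y',
    sr_eqv x x' -> sr_eqv y y' -> sr_eqv (sr_mul x y) (sr_mul x' y');
  sr_addA : forall x y z,
    sr_eqv (sr_add x (sr_add y z)) (sr_add (sr_add x y) z);
  sr_addC : forall x y, sr_eqv (sr_add x y) (sr_add y x);
  sr_add0 : forall x, sr_eqv (sr_add sr_zero x) x;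
  sr_addN : forall x, sr_eqv (sr_add (sr_opp x) x) sr_zero;
  sr_mulA : forall x y z,
    sr_eqv (sr_mul x (sr_mul y z)) (sr_mul (sr_mul x y) z);
  sr_mulC : forall x y, sr_eqv (sr_mul x y) (sr_mul y x);
  sr_mul1 : forall x, sr_eqv (sr_mul sr_one x) x;
  sr_mulDl : forall x y z,
    sr_eqv (sr_mul (sr_add x y) z) (sr_add (sr_mul x z) (sr_mul y z))
}.

Section Quotient.
Variable S : setoid_ring.

Definition sr_rel : rel S := fun x y => `[< sr_eqv x y >].

Lemma sr_rel_refl : reflexive sr_rel.
Proof. by move=> x; apply/asboolP; exact: sr_refl. Qed.

Lemma sr_rel_sym : symmetric sr_rel.
Proof. by move=> x y; apply/asboolP/asboolP; exact: sr_sym. Qed.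

Lemma sr_rel_trans : transitive sr_rel.
Proof.
by move=> y x z /asboolP xy /asboolP yz; apply/asboolP; exact: sr_trans xy yz.
Qed.

Definition sr_equiv := EquivRel sr_rel sr_rel_refl sr_rel_sym sr_rel_trans.

Definition quot := {eq_quot sr_equiv}.
HB.instance Definition _ := Choice.on quot.

Definition to_quot (x : S) : quot := \pi_({eq_quot sr_equiv}) x.

Lemma to_quotP (x y : S) : to_quot x = to_quot y <-> sr_eqv x y.
Proof.
split; first by move=> /eqmodP /asboolP.
by move=> xy; apply/eqmodP/asboolP.
Qed.

Definition quot_repr (q : quot) : S := repr (q : {eq_quot sr_equiv}).

Lemma quot_reprK (q : quot) : to_quot (quot_repr q) = q.
Proof. exact: (@reprK _ {eq_quot sr_equiv}). Qed.

Lemma sr_eqv_repr (x : S) : sr_eqv (quot_repr (to_quot x)) x.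
Proof. by apply/to_quotP; rewrite quot_reprK. Qed.

Definition quot_opp q := to_quot (sr_opp (quot_repr q)).
Definition quot_add p q := to_quot (sr_add (quot_repr p) (quot_repr q)).
Definition quot_mul p q := to_quot (sr_mul (quot_repr p) (quot_repr q)).

Lemma quot_oppE x : quot_opp (to_quot x) = to_quot (sr_opp x).
Proof. by apply/to_quotP; apply: sr_opp_eqv; exact: sr_eqv_repr. Qed.

Lemma quot_addE x y : quot_add (to_quot x) (to_quot y) = to_quot (sr_add x y).
Proof. by apply/to_quotP; apply: sr_add_eqv; exact: sr_eqv_repr. Qed.

Lemma quot_mulE x y : quot_mul (to_quot x) (to_quot y) = to_quot (sr_mul x y).
Proof. by apply/to_quotP; apply: sr_mul_eqv; exact: sr_eqv_repr. Qed.

Lemma quot_ind (P : quot -> Prop) : (forall x, P (to_quot x)) -> forall q, P q.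
Proof. by move=> h q; rewrite -(quot_reprK q). Qed.

Lemma quot_addA : associative quot_add.
Proof.
elim/quot_ind=> x; elim/quot_ind=> y; elim/quot_ind=> z.
by rewrite !quot_addE; apply/to_quotP; exact: sr_addA.
Qed.

Lemma quot_addC : commutative quot_add.
Proof.
elim/quot_ind=> x; elim/quot_ind=> y.
by rewrite !quot_addE; apply/to_quotP; exact: sr_addC.
Qed.

Lemma quot_add0 : left_id (to_quot (sr_zero S)) quot_add.
Proof.
by elim/quot_ind=> x; rewrite quot_addE; apply/to_quotP; exact: sr_add0.
Qed.

Lemma quot_addN : left_inverse (to_quot (sr_zero S)) quot_opp quot_add.
Proof.
elim/quot_ind=> x.
by rewrite quot_oppE quot_addE; apply/to_quotP; exact: sr_addN.
Qed.

Lemma quot_mulA : associative quot_mul.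
Proof.
elim/quot_ind=> x; elim/quot_ind=> y; elim/quot_ind=> z.
by rewrite !quot_mulE; apply/to_quotP; exact: sr_mulA.
Qed.

Lemma quot_mulC : commutative quot_mul.
Proof.
elim/quot_ind=> x; elim/quot_ind=> y.
by rewrite !quot_mulE; apply/to_quotP; exact: sr_mulC.
Qed.

Lemma quot_mul1 : left_id (to_quot (sr_one S)) quot_mul.
Proof.
by elim/quot_ind=> x; rewrite quot_mulE; apply/to_quotP; exact: sr_mul1.
Qed.

Lemma quot_mulDl : left_distributive quot_mul quot_add.
Proof.
elim/quot_ind=> x; elim/quot_ind=> y; elim/quot_ind=> z.
by rewrite !(quot_addE, quot_mulE); apply/to_quotP; exact: sr_mulDl.
Qed.

HB.instance Definition _ :=
  GRing.isZmodule.Build quot quot_addA quot_addC quot_add0 quot_addN.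
HB.instance Definition _ := GRing.Zmodule_isComPzRing.Build quot
  quot_mulA quot_mulC quot_mul1 quot_mulDl.

End Quotient.

(* Presheaves and sheaves of commutative rings (the zero ring is allowed).    *)
Record opens (T : topologicalType) := Opens {
  opens_set :> set T;
  opensP : open opens_set
}.

Record presheaf (T : topologicalType) := Presheaf {
  sect :> opens T -> comPzRingType;
  res : forall U V : opens T, V `<=` U -> {rmorphism sect U -> sect V};
  res_id : forall (U : opens T) (UU : U `<=` U) (s : sect U), res UU s = s;
  res_comp : forall (U V W : opens T)
    (VU : V `<=` U) (WV : W `<=` V) (WU : W `<=` U) (s : sect U),
    res WV (res VU s) = res WU s
}.

Definition opensI (T : topologicalType) (U V : opens T) : opens T :=
  Opens (openI (opensP U) (opensP V)).

Lemma opensIl (T : topologicalType) (U V : opens T) : opensI U V `<=` U.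
Proof. exact: subIsetl. Qed.

Lemma opensIr (T : topologicalType) (U V : opens T) : opensI U V `<=` V.
Proof. exact: subIsetr. Qed.

Lemma res_trans (T : topologicalType) (F : presheaf T) (U V W : opens T)
    (VU : V `<=` U) (WV : W `<=` V) (s : F U) :
  res F WV (res F VU s) = res F (subset_trans WV VU) s.
Proof. exact: res_comp. Qed.

Lemma res_irr (T : topologicalType) (F : presheaf T) (U V : opens T)
    (h h' : V `<=` U) (s : F U) : res F h s = res F h' s.
Proof. by rewrite (Prop_irrelevance h h'). Qed.

Definition sheaf (T : topologicalType) (F : presheaf T) : Prop :=
  forall (I : Type) (U : opens T) (V : I -> opens T)
    (VU : forall i, V i `<=` U), U `<=` \bigcup_i V i ->
    forall s : (forall i, F (V i)),
    (forall i j,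
      res F (@opensIl _ (V i) (V j)) (s i) =
      res F (@opensIr _ (V i) (V j)) (s j)) ->
    exists! t : F U, forall i, res F (VU i) t = s i.

Section Stalk.
Variables (T : topologicalType) (F : presheaf T) (x : T).

Record germ := Germ {
  germ_dom : opens T;
  germ_in : opens_set germ_dom x;
  germ_sect : F germ_dom
}.

HB.instance Definition _ := gen_eqMixin germ.
HB.instance Definition _ := gen_choiceMixin germ.

Definition germ_eqv (s t : germ) : Prop :=
  exists (W : opens T) (Ws : W `<=` germ_dom s) (Wt : W `<=` germ_dom t),
    opens_set W x /\ res F Ws (germ_sect s) = res F Wt (germ_sect t).

Definition germ_op1 (op : forall U, F U -> F U) (s : germ) : germ :=
  Germ (germ_in s) (op _ (germ_sect s)).

Definition germ_op2 (op : forall U, F U -> F U -> F U) (s t : germ) : germ :=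
  @Germ (opensI (germ_dom s) (germ_dom t)) (conj (germ_in s) (germ_in t))
    (op _ (res F (@opensIl _ _ _) (germ_sect s))
          (res F (@opensIr _ _ _) (germ_sect t))).

Definition opensT : opens T := Opens openT.

Definition germ_cst (c : forall U, F U) : germ := @Germ opensT I (c opensT).

Lemma germ_refl s : germ_eqv s s.
Proof.
by exists (germ_dom s), (@subset_refl _ _), (@subset_refl _ _); split=> //; case: s.
Qed.

Lemma germ_sym s t : germ_eqv s t -> germ_eqv t s.
Proof. by case=> W [Ws [Wt [Wx e]]]; exists W, Wt, Ws. Qed.

Lemma germ_trans s t u : germ_eqv s t -> germ_eqv t u -> germ_eqv s u.
Proof.
move=> [V [Vs [Vt [Vx eV]]]] [W [Wt [Wu [Wx eW]]]].
have IV : opensI V W `<=` V by exact: subIsetl.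
have IW : opensI V W `<=` W by exact: subIsetr.
exists (opensI V W), (subset_trans IV Vs), (subset_trans IW Wu); split=> //.
rewrite -(res_comp Vs IV) eV (res_comp _ _ (subset_trans IV Vt)).
by rewrite -(res_comp Wu IW) -eW (res_comp _ _ (subset_trans IV Vt)).
Qed.

Lemma germ_op1_eqv op :
  (forall (U V : opens T) (VU : V `<=` U) (a : F U),
    res F VU (op U a) = op V (res F VU a)) ->
  forall s t, germ_eqv s t -> germ_eqv (germ_op1 op s) (germ_op1 op t).
Proof.
move=> hop s t [W [Ws [Wt [Wx e]]]].
by exists W, Ws, Wt; split=> //=; rewrite !hop e.
Qed.

Lemma germ_op2_eqv op :
  (forall (U V : opens T) (VU : V `<=` U) (a b : F U),
    res F VU (op U a b) = op V (res F VU a) (res F VU b)) ->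
  forall s s' t t', germ_eqv s s' -> germ_eqv t t' ->
    germ_eqv (germ_op2 op s t) (germ_op2 op s' t').
Proof.
move=> hop s s' t t' [V [Vs [Vs' [Vx eV]]]] [W [Wt [Wt' [Wx eW]]]].
have IV : opensI V W `<=` V by exact: subIsetl.
have IW : opensI V W `<=` W by exact: subIsetr.
exists (opensI V W), (setISS Vs Wt), (setISS Vs' Wt'); split=> //=.
rewrite !hop !(res_comp _ _ (subset_trans IV Vs)).
rewrite !(res_comp _ _ (subset_trans IW Wt)).
rewrite !(res_comp _ _ (subset_trans IV Vs')).
rewrite !(res_comp _ _ (subset_trans IW Wt')).
rewrite -(res_comp Vs IV) eV (res_comp _ _ (subset_trans IV Vs')).
by rewrite -(res_comp Wt IW) eW (res_comp _ _ (subset_trans IW Wt')).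
Qed.

Lemma germ_eqv_res (s t : germ) (h : germ_dom s `<=` germ_dom t) :
  germ_sect s = res F h (germ_sect t) -> germ_eqv s t.
Proof.
move=> e; exists (germ_dom s), (@subset_refl _ _), h.
by split; [exact: germ_in | rewrite res_id].
Qed.

Let add U := @GRing.add (F U).
Let opp U := @GRing.opp (F U).
Let mul U := @GRing.mul (F U).

Let addP (U V : opens T) (VU : V `<=` U) a b :
  res F VU (add a b) = add (res F VU a) (res F VU b).
Proof. exact: raddfD. Qed.
Let mulP (U V : opens T) (VU : V `<=` U) a b :
  res F VU (mul a b) = mul (res F VU a) (res F VU b).
Proof. exact: rmorphM. Qed.
Let oppP (U V : opens T) (VU : V `<=` U) a :
  res F VU (opp a) = opp (res F VU a).
Proof. exact: raddfN. Qed.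

Lemma germ_opA op :
  (forall (U V : opens T) (VU : V `<=` U) (a b : F U),
    res F VU (op U a b) = op V (res F VU a) (res F VU b)) ->
  (forall U, associative (op U)) ->
  forall s t u, germ_eqv (germ_op2 op s (germ_op2 op t u))
                         (germ_op2 op (germ_op2 op s t) u).
Proof.
move=> hop opA s t u.
have h : germ_dom (germ_op2 op s (germ_op2 op t u)) `<=`
         germ_dom (germ_op2 op (germ_op2 op s t) u) by move=> y [? []].
apply: (@germ_eqv_res _ _ h) => /=; rewrite !hop opA.
by rewrite !res_trans; congr (op _ (op _ _ _) _); exact: res_irr.
Qed.

Lemma germ_opC op : (forall U, commutative (op U)) ->
  (forall (U V : opens T) (VU : V `<=` U) (a b : F U),
    res F VU (op U a b) = op V (res F VU a) (res F VU b)) ->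
  forall s t, germ_eqv (germ_op2 op s t) (germ_op2 op t s).
Proof.
move=> opC hop s t.
have h : germ_dom (germ_op2 op s t) `<=` germ_dom (germ_op2 op t s).
  by move=> y [].
apply: (@germ_eqv_res _ _ h) => /=; rewrite !hop opC.
by rewrite !res_trans; congr (op _ _ _); exact: res_irr.
Qed.

Lemma germ_op_id op (c : forall U, F U) : (forall U, left_id (c U) (op U)) ->
  (forall (U V : opens T) (VU : V `<=` U), res F VU (c U) = c V) ->
  forall s, germ_eqv (germ_op2 op (germ_cst c) s) s.
Proof.
move=> op1 hc s.
have h : germ_dom (germ_op2 op (germ_cst c) s) `<=` germ_dom s.
  exact: subIsetr.
by apply: (@germ_eqv_res _ _ h) => /=; rewrite hc op1; exact: res_irr.
Qed.

Let zero U : F U := 0.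
Let one U : F U := 1.

Let zeroP (U V : opens T) (VU : V `<=` U) : res F VU (zero U) = zero V.
Proof. exact: raddf0. Qed.
Let oneP (U V : opens T) (VU : V `<=` U) : res F VU (one U) = one V.
Proof. exact: rmorph1. Qed.

Lemma germ_addN s :
  germ_eqv (germ_op2 add (germ_op1 opp s) s) (germ_cst zero).
Proof.
have h : germ_dom (germ_op2 add (germ_op1 opp s) s) `<=`
         germ_dom (germ_cst zero) by [].
apply: (@germ_eqv_res _ _ h) => /=; rewrite zeroP oppP.
rewrite (_ : res F (@opensIr _ _ _) _ = res F (@opensIl _ _ _) (germ_sect s)).
  exact: addNr.
exact: res_irr.
Qed.

Lemma germ_mulDl s t u :
  germ_eqv (germ_op2 mul (germ_op2 add s t) u)
           (germ_op2 add (germ_op2 mul s u) (germ_op2 mul t u)).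
Proof.
have h : germ_dom (germ_op2 mul (germ_op2 add s t) u) `<=`
  germ_dom (germ_op2 add (germ_op2 mul s u) (germ_op2 mul t u)).
  by move=> y [[? ?] ?].
apply: (@germ_eqv_res _ _ h) => /=; rewrite !(addP, mulP).
rewrite [LHS]mulrDl !res_trans.
by congr (_ * _ + _ * _); exact: res_irr.
Qed.

Definition stalk_setoid : setoid_ring := @SetoidRing germ germ_eqv
  (germ_cst zero) (germ_cst one) (germ_op1 opp) (germ_op2 add) (germ_op2 mul)
  germ_refl germ_sym germ_trans
  (germ_op1_eqv oppP) (germ_op2_eqv addP) (germ_op2_eqv mulP)
  (germ_opA addP (fun U => @addrA (F U)))
  (germ_opC (fun U => @addrC (F U)) addP)
  (germ_op_id (fun U => @add0r (F U)) zeroP) germ_addN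
  (germ_opA mulP (fun U => @mulrA (F U)))
  (germ_opC (fun U => @mulrC (F U)) mulP)
  (germ_op_id (fun U => @mul1r (F U)) oneP) germ_mulDl.

Definition stalk : comPzRingType := quot stalk_setoid.

End Stalk.

Definition locally_ringed (T : topologicalType) (F : presheaf T) : Prop :=
  sheaf F /\ forall x : T, local [set: stalk F x].

Section Restriction.
Variables (T : topologicalType) (F : presheaf T) (U : opens T).

Lemma open_set_val (V : opens (set_type U)) :
  open (@set_val _ (U : set T) @` V).
Proof.
have [W oW WV] := opensP V.
suff -> : @set_val _ (U : set T) @` V = W `&` U.
  by apply: openI => //; exact: opensP.
rewrite -WV; apply/seteqP; split=> [_ [y Wy <-]|y [Wy Uy]].
  by split=> //; apply: set_valP.
by exists (SigSub (mem_set Uy)).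
Qed.

Definition opens_image (V : opens (set_type U)) : opens T :=
  Opens (open_set_val V).

Definition presheaf_restrict : presheaf (set_type U) := @Presheaf (set_type U)
  (fun V => F (opens_image V))
  (fun V W (WV : W `<=` V) => res F (image_subset (@set_val _ (U : set T)) WV
     : opens_image W `<=` opens_image V))
  (fun V _ s => res_id _ s)
  (fun V W Z _ _ _ s => res_comp _ _ _ s).

End Restriction.

(* An isomorphism of locally ringed spaces is a homeomorphism together with   *)
(* an isomorphism of sheaves; the maps it induces on stalks are then          *)
(* isomorphisms, hence local.                                                 *)
Section Iso.
Variables (X Y : topologicalType) (F : presheaf X) (G : presheaf Y).

Definition opens_preimage (f : X -> Y) (cf : continuous f) (V : opens Y) :
  opens X := Opens (open_comp (fun x _ => cf x) (opensP V)).

Record ringed_iso := RingedIso {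
  iso_fun : X -> Y;
  iso_inv : Y -> X;
  iso_funK : cancel iso_fun iso_inv;
  iso_invK : cancel iso_inv iso_fun;
  iso_cont : continuous iso_fun;
  iso_inv_cont : continuous iso_inv;
  iso_sect : forall V : opens Y,
    {rmorphism G V -> F (opens_preimage iso_cont V)};
  iso_sect_res : forall (V W : opens Y) (WV : W `<=` V) (s : G V),
    iso_sect W (res G WV s) =
    res F (preimage_subset WV
      : opens_preimage iso_cont W `<=` opens_preimage iso_cont V)
      (iso_sect V s);
  iso_sect_bij : forall V : opens Y, bijective (iso_sect V)
}.

End Iso.

Record Spec (A : comPzRingType) := SpecPoint {
  spec_prime :> set A;
  spec_primeP : prime_ideal [set: A] spec_prime
}.

HB.instance Definition _ (A : comPzRingType) := gen_eqMixin (Spec A).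
HB.instance Definition _ (A : comPzRingType) := gen_choiceMixin (Spec A).

Section SpecTopology.
Variable A : comPzRingType.
Implicit Types p : Spec A.

Lemma spec1 p : ~ spec_prime p 1.
Proof. by have [] := spec_primeP p. Qed.

Lemma specM p (a b : A) : ~ spec_prime p a -> ~ spec_prime p b -> ~ spec_prime p (a * b).
Proof. by move=> pa pb; have [_ _ /(_ a b I I) h /h []] := spec_primeP p. Qed.

Lemma spec_mulr p (a b : A) : spec_prime p b -> spec_prime p (a * b).
Proof. by move=> pb; have [[_ _ _ h] _ _] := spec_primeP p; exact: h. Qed.

(* The complement of the closed set V(E).                                     *)
Definition spec_nonvanishing (E : set A) : set (Spec A) :=
  [set p : Spec A | ~ (E `<=` p)].

Definition spec_open (U : set (Spec A)) : Prop :=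
  exists E : set A, U = spec_nonvanishing E.

Lemma spec_openT : spec_open setT.
Proof.
exists setT; apply/seteqP; split=> // p _ h.
by apply: (@spec1 p); exact: h.
Qed.

Lemma spec_nonvanishingP (E : set A) p :
  spec_nonvanishing E p <-> exists2 a, E a & ~ spec_prime p a.
Proof.
split=> [h|[a Ea pa] /(_ a Ea)//]; apply: contrapT => h'.
apply: h => a Ea; apply: contrapT => pa.
by apply: h'; exists a.
Qed.

Lemma spec_openI : setI_closed spec_open.
Proof.
move=> _ _ [E ->] [E' ->]; exists [set a * b | a in E & b in E'].
apply/seteqP; split=> p.
  move=> [/spec_nonvanishingP [a Ea pa] /spec_nonvanishingP [b Eb pb]].
  apply/spec_nonvanishingP; exists (a * b); first by exists a => //; exists b.
  exact: specM.
move=> /spec_nonvanishingP [_ [a Ea [b Eb <-]] pab].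
split; apply/spec_nonvanishingP; [exists a|exists b] => // ?; apply: pab.
  by rewrite mulrC; exact: spec_mulr.
exact: spec_mulr.
Qed.

Lemma spec_open_bigU (I : Type) (f : I -> set (Spec A)) :
  (forall i, spec_open (f i)) -> spec_open (\bigcup_i f i).
Proof.
move=> /choice [E fE]; exists (\bigcup_i E i); apply/seteqP; split=> p.
  move=> [i _]; rewrite fE => /spec_nonvanishingP [a Ea pa].
  by apply/spec_nonvanishingP; exists a => //; exists i.
move=> /spec_nonvanishingP [a [i _ Ea] pa]; exists i => //; rewrite fE.
by apply/spec_nonvanishingP; exists a.
Qed.

HB.instance Definition _ := @isOpenTopological.Build (Spec A)
  spec_open spec_openT spec_openI spec_open_bigU.

End SpecTopology.

Section Localization.
Variables (A : comPzRingType) (p : Spec A).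

Record frac := Frac { num : A; den : A; denP : ~ spec_prime p den }.
Arguments denP : clear implicits.

HB.instance Definition _ := gen_eqMixin frac.
HB.instance Definition _ := gen_choiceMixin frac.

Definition frac_eqv (x y : frac) : Prop :=
  exists2 u : A, ~ spec_prime p u & u * (num x * den y) = u * (num y * den x).

Definition frac_cst (a : A) : frac := @Frac a 1 (@spec1 A p).
Definition frac_opp (x : frac) : frac := Frac (- num x) (denP x).
Definition frac_add (x y : frac) : frac :=
  Frac (num x * den y + num y * den x) (specM (denP x) (denP y)).
Definition frac_mul (x y : frac) : frac :=
  Frac (num x * num y) (specM (denP x) (denP y)).

Lemma frac_eqv1 x y : num x * den y = num y * den x -> frac_eqv x y.
Proof. by move=> e; exists 1; [exact: spec1|rewrite e]. Qed.

Lemma frac_refl x : frac_eqv x x.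
Proof. exact: frac_eqv1. Qed.

Lemma frac_sym x y : frac_eqv x y -> frac_eqv y x.
Proof. by case=> u pu e; exists u. Qed.

Lemma frac_trans x y z : frac_eqv x y -> frac_eqv y z -> frac_eqv x z.
Proof.
move=> [u pu eu] [v pv ev]; exists (u * v * den y).
  by apply: specM (denP y); exact: specM.
transitivity (v * den z * (u * (num x * den y))); first by ring.
rewrite eu; transitivity (u * den x * (v * (num y * den z))); first by ring.
by rewrite ev; ring.
Qed.

Lemma frac_opp_eqv x y : frac_eqv x y -> frac_eqv (frac_opp x) (frac_opp y).
Proof. by case=> u pu e; exists u => //=; rewrite !mulNr !mulrN e. Qed.

Lemma frac_add_eqv x x' y y' : frac_eqv x x' -> frac_eqv y y' ->
  frac_eqv (frac_add x y) (frac_add x' y').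
Proof.
move=> [u pu eu] [v pv ev]; exists (u * v); first exact: specM.
move=> /=; transitivity (v * den y * den y' * (u * (num x * den x'))
  + u * den x * den x' * (v * (num y * den y'))); first by ring.
by rewrite eu ev; ring.
Qed.

Lemma frac_mul_eqv x x' y y' : frac_eqv x x' -> frac_eqv y y' ->
  frac_eqv (frac_mul x y) (frac_mul x' y').
Proof.
move=> [u pu eu] [v pv ev]; exists (u * v); first exact: specM.
move=> /=; transitivity ((u * (num x * den x')) * (v * (num y * den y'))).
  by ring.
by rewrite eu ev; ring.
Qed.

Definition localization_setoid : setoid_ring.
Proof.
apply: (@SetoidRing frac frac_eqv (frac_cst 0) (frac_cst 1) frac_opp
  frac_add frac_mul frac_refl frac_sym frac_trans
  frac_opp_eqv frac_add_eqv frac_mul_eqv).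
all: by move=> *; apply: frac_eqv1 => /=; ring.
Defined.

Definition localization : comPzRingType := quot localization_setoid.

Definition to_localization (a f : A) (pf : ~ spec_prime p f) : localization :=
  @to_quot localization_setoid (Frac a pf).

End Localization.

Section SpecSheaf.
Variable A : comPzRingType.

Definition spec_family (U : opens (Spec A)) : Type :=
  forall p : Spec A, opens_set U p -> localization p.

Section Family.
Variable U : opens (Spec A).
Local Notation S := (spec_family U).
Implicit Types s t : S.

HB.instance Definition _ := gen_eqMixin S.
HB.instance Definition _ := gen_choiceMixin S.

Definition family_zero : S := fun p _ => 0.
Definition family_one : S := fun p _ => 1.
Definition family_opp s : S := fun p Up => - s p Up.
Definition family_add s t : S := fun p Up => s p Up + t p Up.
Definition family_mul s t : S := fun p Up => s p Up * t p Up.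

Lemma family_ext s t : (forall p Up, s p Up = t p Up) -> s = t.
Proof. by move=> h; apply: functional_extensionality_dep => p; exact: funext. Qed.

Lemma family_addA : associative family_add.
Proof. by move=> s t u; apply: family_ext => p Up; exact: addrA. Qed.
Lemma family_addC : commutative family_add.
Proof. by move=> s t; apply: family_ext => p Up; exact: addrC. Qed.
Lemma family_add0 : left_id family_zero family_add.
Proof. by move=> s; apply: family_ext => p Up; exact: add0r. Qed.
Lemma family_addN : left_inverse family_zero family_opp family_add.
Proof. by move=> s; apply: family_ext => p Up; exact: addNr. Qed.
Lemma family_mulA : associative family_mul.
Proof. by move=> s t u; apply: family_ext => p Up; exact: mulrA. Qed.
Lemma family_mulC : commutative family_mul.
Proof. by move=> s t; apply: family_ext => p Up; exact: mulrC. Qed.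
Lemma family_mul1 : left_id family_one family_mul.
Proof. by move=> s; apply: family_ext => p Up; exact: mul1r. Qed.
Lemma family_mulDl : left_distributive family_mul family_add.
Proof. by move=> s t u; apply: family_ext => p Up; exact: mulrDl. Qed.

HB.instance Definition _ :=
  GRing.isZmodule.Build S family_addA family_addC family_add0 family_addN.
HB.instance Definition _ := GRing.Zmodule_isComPzRing.Build S
  family_mulA family_mulC family_mul1 family_mulDl.

(* Sections over [U] are the families (s_p in A_p)_(p in U) that are, near    *)
(* every point, given by a single fraction a / f.                             *)
Definition locally_fraction (s : S) : Prop :=
  forall p, opens_set U p -> exists V : opens (Spec A),
    [/\ opens_set V p, V `<=` U & exists a f : A,
      forall q (Uq : opens_set U q), opens_set V q ->
        exists qf : ~ spec_prime q f, s q Uq = to_localization a qf].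

Definition spec_sections : {pred S} := fun s => `[< locally_fraction s >].

Lemma to_localizationB (p : Spec A) (a b f g : A)
    (pf : ~ spec_prime p f) (pg : ~ spec_prime p g) :
  to_localization a pf - to_localization b pg =
  to_localization (a * g - b * f) (specM pf pg).
Proof.
rewrite /to_localization [X in _ + X = _]quot_oppE [LHS]quot_addE.
by apply/to_quotP; apply: frac_eqv1 => /=; ring.
Qed.

Lemma to_localizationM (p : Spec A) (a b f g : A)
    (pf : ~ spec_prime p f) (pg : ~ spec_prime p g) :
  to_localization a pf * to_localization b pg =
  to_localization (a * b) (specM pf pg).
Proof. exact: quot_mulE. Qed.

Lemma spec_sections_closed : subring_closed spec_sections.
Proof.
split.
- apply/asboolP => p Up; exists U; split=> //; exists 1, 1 => q Uq _.
  by exists (@spec1 _ q).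
- move=> s t /asboolP hs /asboolP ht; apply/asboolP => p Up.
  have [V [Vp VU [a [f hV]]]] := hs p Up.
  have [W [Wp WU [b [g hW]]]] := ht p Up.
  exists (opensI V W); split=> //; first by move=> q [/VU].
  exists (a * g - b * f), (f * g) => q Uq [Vq Wq].
  have [qf ef] := hV q Uq Vq; have [qg eg] := hW q Uq Wq.
  by exists (specM qf qg); rewrite -to_localizationB -ef -eg.
- move=> s t /asboolP hs /asboolP ht; apply/asboolP => p Up.
  have [V [Vp VU [a [f hV]]]] := hs p Up.
  have [W [Wp WU [b [g hW]]]] := ht p Up.
  exists (opensI V W); split=> //; first by move=> q [/VU].
  exists (a * b), (f * g) => q Uq [Vq Wq].
  have [qf ef] := hV q Uq Vq; have [qg eg] := hW q Uq Wq.
  by exists (specM qf qg); rewrite -to_localizationM -ef -eg.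
Qed.

Record spec_section := SpecSection {
  section_family :> S;
  section_familyP : section_family \in spec_sections
}.

HB.instance Definition _ := [isSub for section_family].
HB.instance Definition _ := [Choice of spec_section by <:].
HB.instance Definition _ := GRing.SubChoice_isSubComPzRing.Build S
  spec_sections spec_section spec_sections_closed.

End Family.

Section Res.
Variables (U V : opens (Spec A)) (VU : V `<=` U).

Definition family_res (s : spec_family U) : spec_family V :=
  fun p Vp => s p (VU Vp).

Lemma family_resP (s : spec_section U) :
  family_res s \in @spec_sections V.
Proof.
have /asboolP hs := section_familyP s; apply/asboolP => p Vp.
have [W [Wp WU [a [f h]]]] := hs p (VU Vp).
exists (opensI W V); split=> //; first exact: opensIr.
by exists a, f => q Vq [Wq _]; exact: h.
Qed.

Definition spec_res (s : spec_section U) : spec_section V :=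
  SpecSection (family_resP s).

Lemma spec_res_zmod : zmod_morphism spec_res.
Proof. by move=> s t; apply: val_inj. Qed.

Lemma spec_res_monoid : monoid_morphism spec_res.
Proof. by split=> [|s t]; apply: val_inj. Qed.

HB.instance Definition _ := GRing.isZmodMorphism.Build
  (spec_section U) (spec_section V) spec_res spec_res_zmod.
HB.instance Definition _ := GRing.isMonoidMorphism.Build
  (spec_section U) (spec_section V) spec_res spec_res_monoid.

End Res.

Lemma spec_res_id (U : opens (Spec A)) (UU : U `<=` U) (s : spec_section U) :
  spec_res UU s = s.
Proof.
apply: val_inj; apply: family_ext => p Up /=.
by rewrite /family_res (Prop_irrelevance (UU p Up) Up).
Qed.

Lemma spec_res_comp (U V W : opens (Spec A)) (VU : V `<=` U) (WV : W `<=` V)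
    (WU : W `<=` U) (s : spec_section U) :
  spec_res WV (spec_res VU s) = spec_res WU s.
Proof.
apply: val_inj; apply: family_ext => p Wp /=.
by rewrite /family_res /= (Prop_irrelevance (VU p (WV p Wp)) (WU p Wp)).
Qed.

Definition spec_presheaf : presheaf (Spec A) := @Presheaf (Spec A)
  (fun U => spec_section U)
  (fun U V VU => spec_res VU)
  spec_res_id spec_res_comp.

End SpecSheaf.

Definition affine (T : topologicalType) (F : presheaf T) : Prop :=
  exists A : comPzRingType, inhabited (ringed_iso F (spec_presheaf A)).

Definition scheme (T : topologicalType) (F : presheaf T) : Prop :=
  locally_ringed F /\ forall x : T,
    exists2 U : opens T, opens_set U x & affine (presheaf_restrict F U).

Definition integral (T : topologicalType) (F : presheaf T) : Prop :=
  [set: T] !=set0 /\ forall U : opens T, U !=set0 -> domain (F U).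

Definition quasi_compact (T : topologicalType) : Prop :=
  cover_compact [set: T].

Definition quasi_separated (T : topologicalType) : Prop :=
  forall U V : set T, open U -> open V -> cover_compact U -> cover_compact V ->
    cover_compact (U `&` V).

Definition zero_ring : Type := unit.

HB.instance Definition _ := Choice.on zero_ring.

Definition zr_opp (x : zero_ring) : zero_ring := tt.
Definition zr_op (x y : zero_ring) : zero_ring := tt.

Lemma zr_id : left_id (tt : zero_ring) zr_op. Proof. by case. Qed.

HB.instance Definition _ := @GRing.isZmodule.Build zero_ring tt zr_opp zr_op
  (fun _ _ _ => erefl) (fun _ _ => erefl) zr_id (fun _ => erefl).
HB.instance Definition _ := @GRing.Zmodule_isComPzRing.Build zero_ring tt zr_op
  (fun _ _ _ => erefl) (fun _ _ => erefl) zr_id (fun _ _ _ => erefl).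

Record subring (K : fieldType) := Subring {
  subring_set :> set K;
  subringP : subring_closed [in subring_set]
}.

HB.instance Definition _ (K : fieldType) := gen_eqMixin (subring K).
HB.instance Definition _ (K : fieldType) := gen_choiceMixin (subring K).

Section Models.
Variables (K : fieldType).
Implicit Types (A B R S V D : subring K) (X : set (subring K)).

Definition has_fraction_field R : Prop :=
  forall x : K, exists a b : K,
    [/\ subring_set R a, subring_set R b, b != 0 & x = a / b].

(* L(K/D).                                                                    *)
Definition local_domains D : set (subring K) :=
  [set R : subring K | [/\ D `<=` R, local R & has_fraction_field R]].

(* The localization A_P, as a subset of K.                                    *)
Definition subring_loc A (P : set K) : set K :=
  [set x | exists a s : K,
    [/\ subring_set A a, subring_set A s, ~ P s & x = a / s]].

(* S(A).                                                                      *)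
Definition localizations A : set (subring K) :=
  [set R : subring K | exists2 P : set K,
    prime_ideal A P & R = subring_loc A P :> set K].

(* [S] dominates [R]; only used for local rings, where the maximal ideals MS  *)
(* and MR are unique.                                                         *)
Definition dominates S R : Prop :=
  R `<=` S /\ exists MS MR : set K,
    [/\ maximal_ideal S MS, maximal_ideal R MR & MR = MS `&` R].

Definition valuation_ring V : Prop :=
  forall x : K, x != 0 -> subring_set V x \/ subring_set V x^-1.

Definition premodel D X : Prop := X !=set0 /\ X `<=` local_domains D.

Definition irredundant X : Prop :=
  forall R S V, X R -> X S -> valuation_ring V ->
    dominates V R -> dominates V S -> R = S.

(* The subring D[H] of K, with H finite.                                      *)
Definition affine_ring D A : Prop :=
  exists2 H : set K, finite_set H &
    A = smallest (fun B : set K => subring_closed [in B]) (D `|` H) :> set K.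

Definition model D X : Prop :=
  [/\ premodel D X, irredundant X
    & exists (n : nat) (E : 'I_n -> subring K),
        (forall i, affine_ring D (E i)) /\ X = \bigcup_i localizations (E i)].

Lemma subring_bigcap_closed (I : Type) (P : set I) (f : I -> subring K) :
  subring_closed [in \bigcap_(i in P) (f i : set K)].
Proof.
split=> [|x y|x y].
- by rewrite inE => i _; have [/set_mem] := subringP (f i).
- rewrite !inE => hx hy i Pi; have [_ h _] := subringP (f i).
  by apply: set_mem; apply: h; apply: mem_set; [exact: hx|exact: hy].
- rewrite !inE => hx hy i Pi; have [_ _ h] := subringP (f i).
  by apply: set_mem; apply: h; apply: mem_set; [exact: hx|exact: hy].
Qed.

Definition subring_bigcap (I : Type) (P : set I) (f : I -> subring K) :
  subring K := Subring (subring_bigcap_closed P f).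

Definition subring_type A : Type := {x : K | x \in subring_set A}.

HB.instance Definition _ A := SubChoice.on (subring_type A).
HB.instance Definition _ A := GRing.SubChoice_isSubComPzRing.Build K
  [in subring_set A] (subring_type A) (subringP A).

(* Sections over U are an intersection of subrings of K if U is nonempty, but *)
(* the zero ring if U is empty; [P] stands for the nonemptiness of U.         *)
Definition guarded (P : Prop) (d : {P} + {~ P}) A : comPzRingType :=
  if d then (subring_type A : comPzRingType) else (zero_ring : comPzRingType).

Definition subring_incl A B (AB : A `<=` B) (x : subring_type A) :
  subring_type B := exist _ (val x) (mem_set (AB _ (set_mem (valP x)))).

Definition guarded_res (P Q : Prop) (d : {P} + {~ P}) (e : {Q} + {~ Q}) A B
    (QP : Q -> P) (AB : A `<=` B) : guarded d A -> guarded e B :=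
  match d, e return guarded d A -> guarded e B with
  | left _, left _ => fun x => subring_incl AB x
  | right nP, left q => fun _ => False_rect _ (nP (QP q))
  | _, right _ => fun _ => tt
  end.

Section GuardedRes.
Variables (P Q : Prop) (d : {P} + {~ P}) (e : {Q} + {~ Q}) (A B : subring K).
Variables (QP : Q -> P) (AB : A `<=` B).

Lemma guarded_res_zmod : zmod_morphism (@guarded_res P Q d e A B QP AB).
Proof.
case: d e => [p|np] [q|nq] x y.
- exact: val_inj.
- by [].
- by case: (np (QP q)).
- by [].
Qed.

Lemma guarded_res_monoid : monoid_morphism (@guarded_res P Q d e A B QP AB).
Proof.
case: d e => [p|np] [q|nq]; split=> [|x y].
1-2: exact: val_inj.
1-2: by [].
1-2: by case: (np (QP q)).
all: by [].
Qed.

HB.instance Definition _ := GRing.isZmodMorphism.Build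
  (guarded d A) (guarded e B) (@guarded_res P Q d e A B QP AB) guarded_res_zmod.
HB.instance Definition _ := GRing.isMonoidMorphism.Build
  (guarded d A) (guarded e B) (@guarded_res P Q d e A B QP AB)
  guarded_res_monoid.

End GuardedRes.

Section Space.
Variable X : set (subring K).

Definition zariski_space : Type := set_type X.

HB.instance Definition _ := Choice.on zariski_space.

Definition zariski_ring (x : zariski_space) : subring K := set_val x.

Definition zariski_basis (H : set K) : set zariski_space :=
  [set x : zariski_space | H `<=` zariski_ring x].

Lemma zariski_basis_cover :
  \bigcup_(H in @finite_set K) zariski_basis H = setT.
Proof. by apply/seteqP; split=> // x _; exists set0. Qed.

Lemma zariski_basis_join (H H' : set K) (x : zariski_space) :
  finite_set H -> finite_set H' -> zariski_basis H x -> zariski_basis H' x ->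
  exists J : set K, [/\ finite_set J, zariski_basis J x
    & zariski_basis J `<=` zariski_basis H `&` zariski_basis H'].
Proof.
move=> fH fH' xH xH'; exists (H `|` H'); split.
- by rewrite finite_setU.
- by rewrite /zariski_basis /= subUset.
- by move=> y; rewrite /zariski_basis /= subUset.
Qed.

HB.instance Definition _ := @isBaseTopological.Build zariski_space
  (set K) (@finite_set K) zariski_basis zariski_basis_cover zariski_basis_join.

Definition sections (U : opens zariski_space) : subring K :=
  subring_bigcap (U : set zariski_space) zariski_ring.

Lemma sections_sub (U V : opens zariski_space) :
  V `<=` U -> sections U `<=` sections V.
Proof. by move=> VU x hx y /VU; exact: hx. Qed.

Definition zariski_sect (U : opens zariski_space) : comPzRingType :=
  guarded (pselect ((U : set zariski_space) !=set0)) (sections U).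

Definition zariski_res (U V : opens zariski_space) (VU : V `<=` U) :
    {rmorphism zariski_sect U -> zariski_sect V} :=
  @guarded_res _ _ (pselect ((U : set zariski_space) !=set0))
    (pselect ((V : set zariski_space) !=set0)) _ _
    (subset_nonempty VU) (sections_sub VU).

Lemma zariski_res_id (U : opens zariski_space) (UU : U `<=` U)
    (s : zariski_sect U) :
  zariski_res UU s = s.
Proof.
move: s; rewrite /zariski_res /zariski_sect /guarded_res /=.
by case: pselect => [h|h] s; [exact: val_inj | case: s].
Qed.

Lemma zariski_res_comp (U V W : opens zariski_space)
    (VU : V `<=` U) (WV : W `<=` V) (WU : W `<=` U) (s : zariski_sect U) :
  zariski_res WV (zariski_res VU s) = zariski_res WU s.
Proof.
move: s; rewrite /zariski_res /zariski_sect /guarded_res /=.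
case: pselect => [hU|hU] s; case: pselect => [hV|hV]; case: pselect => [hW|hW];
  rewrite //=; try exact: val_inj.
all: by [case: (hV (subset_nonempty WV hW)) | case: (hU (subset_nonempty WU hW))
  | case: (hU (subset_nonempty VU hV))].
Qed.

Definition zariski_presheaf : presheaf zariski_space :=
  @Presheaf zariski_space zariski_sect zariski_res zariski_res_id zariski_res_comp.

End Space.

End Models.

(* Main.v *)
(* By Chevalley's theorem every local subring of K is dominated by a valuation
   ring, so irredundance forbids two members of X to be dominated by a common
   local ring. Hence, if S(A) is contained in X, then S(A) = {R in X : A <= R},
   and if A and B have this property then so does the ring AB they generate:
   S(A) and S(B) meet in S(AB). A model is thus glued from the finitely many open
   sets S(D_i), each isomorphic to Spec D_i, along affine intersections. Sheaf,
   stalk and isomorphism statements all reduce to computations in K, because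
   every section is determined by its value at the generic point K of X. *)
Require Import Defs.
From HB Require Import structures.
From mathcomp Require Import all_boot all_algebra all_classical topology.
From mathcomp Require Import ring zify finmap.

Set Implicit Arguments.
Unset Strict Implicit.
Unset Printing Implicit Defensive.

Import GRing.Theory.
Local Open Scope classical_set_scope.
Local Open Scope ring_scope.

(** * Subrings of a field, prime ideals and localizations *)

(** Two conventions shape the details. In K one has [0^-1 = 0], which lies in every subring, so each
    notion of unit or nonunit that tests an inverse has to treat zero apart. Sections over the empty
    set form the zero ring and have no faithful value in K, so statements about values carry a
    nonemptiness condition or a point. The generic point lies in every nonempty open set, so two
    nonempty members of a cover always overlap and compatible sections share one value: this is what
    makes gluing possible with intersections of subrings. Domination is replaced by a condition on
    inverses, [unit_reflecting], which composes without mentioning maximal ideals. The members of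
    the affine family are not assumed to have fraction field K; this is recovered from their
    localizations being members of X. *)

(** [Zorn_bigcup] is applied to the sets whose union with [J] satisfies [P]: this forces the maximal
    element above [J], and [P J] settles the empty chain, so that [chain] only has to treat nonempty
    ones. *)
Lemma Zorn_above (T : Type) (P : set (set T)) (J : set T) : P J ->
  (forall F : set (set T), F !=set0 -> F `<=` P -> total_on F subset ->
    P (\bigcup_(I in F) I)) ->
  exists M : set T, [/\ P M, J `<=` M & forall N, P N -> M `<=` N -> N = M].
Proof.
move=> PJ chain.
have [|M [PM maxM]] := @Zorn_bigcup T [set I | P (J `|` I)].
  move=> F FP totF /=; have [F0|/set0P F0] := eqVneq F set0.
    by rewrite F0 bigcup_set0 setU0.
  have -> : J `|` \bigcup_(I in F) I =
            \bigcup_(I in [set J `|` I | I in F]) I.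
    apply/seteqP; split=> x.
      move=> [Jx|[I FI Ix]]; last by exists (J `|` I); [exists I|right].
      by have [I FI] := F0; exists (J `|` I); [exists I|left].
    by move=> [_ [I FI <-] [Jx|Ix]]; [left|right; exists I].
  apply: chain; first by have [I FI] := F0; exists (J `|` I); exists I.
    by move=> _ [I FI <-]; exact: FP.
  move=> _ _ [I FI <-] [I' FI' <-].
  by have [h|h] := totF _ _ FI FI'; [left|right]; exact: setUS.
exists (J `|` M); split=> // N PN MN; apply: contrapT => NM.
have JN : J `<=` N by move=> x Jx; apply: MN; left.
apply: (maxM N); last by rewrite /= ((setUidPr _ _).2 JN).
split=> [x Mx|NM']; first by apply: MN; right.
by apply: NM; apply/seteqP; split=> // x /NM'; right.
Qed.

Section SubringTheory.
Variable K : fieldType.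
Implicit Types (A B R S V : subring K) (P M I J H : set K) (x y a b s t : K).

Lemma subring1 A : subring_set A 1.
Proof. by have [/set_mem] := subringP A. Qed.

Lemma subringB A x y :
  subring_set A x -> subring_set A y -> subring_set A (x - y).
Proof.
by move=> Ax Ay; have [_ h _] := subringP A; apply/set_mem/h; exact: mem_set.
Qed.

Lemma subringM A x y :
  subring_set A x -> subring_set A y -> subring_set A (x * y).
Proof.
by move=> Ax Ay; have [_ _ h] := subringP A; apply/set_mem/h; exact: mem_set.
Qed.

Lemma subring0 A : subring_set A 0.
Proof. by rewrite -(subrr 1); apply: subringB; exact: subring1. Qed.

Lemma subringN A x : subring_set A x -> subring_set A (- x).
Proof. by rewrite -sub0r => Ax; apply: subringB => //; exact: subring0. Qed.

Lemma subringD A x y :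
  subring_set A x -> subring_set A y -> subring_set A (x + y).
Proof. by move=> Ax Ay; rewrite -[y]opprK; apply: subringB => //; exact: subringN. Qed.

Lemma subring_closedP (B : set K) : B 1 ->
  (forall x y, B x -> B y -> B (x - y)) ->
  (forall x y, B x -> B y -> B (x * y)) -> subring_closed [in B].
Proof.
move=> h1 hB hM; split=> [|x y /set_mem Bx /set_mem By|x y /set_mem Bx /set_mem By].
- exact: mem_set.
- by apply: mem_set; exact: hB.
- by apply: mem_set; exact: hM.
Qed.

Lemma subring_eq A B : A = B :> set K -> A = B.
Proof.
case: A B => [A hA] [B hB] /= AB; rewrite AB in hA *.
by rewrite (Prop_irrelevance hA hB).
Qed.

(** Used twice: with [S] closed under products it yields prime ideals, with [S] reduced to 1 it
    yields maximal ideals. *)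
Lemma ideal_maximal_avoiding A I (S : set K) : ideal A I ->
  (forall x, I x -> ~ S x) ->
  exists J, [/\ ideal A J, I `<=` J, forall x, J x -> ~ S x
    & forall N, ideal A N -> (forall x, N x -> ~ S x) -> J `<=` N -> N = J].
Proof.
move=> hI IS.
have [||J [[hJ JS] IJ maxJ]] := @Zorn_above K
  [set J | ideal A J /\ forall x, J x -> ~ S x] I.
- by [].
- move=> F [J0 FJ0] FP totF; split; last by move=> x [J /FP[_ h] /h].
  split.
  + by move=> x [J /FP[[h _ _ _] _] /h].
  + by exists J0 => //; have [[]] := FP _ FJ0.
  + move=> x y [J FJ Jx] [N FN Ny].
    have [JN|NJ] := totF _ _ FJ FN; [exists N|exists J] => //.
      by have [[_ _ h _] _] := FP _ FN; apply: h => //; exact: JN.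
    by have [[_ _ h _] _] := FP _ FJ; apply: h => //; exact: NJ.
  + move=> a x Aa [J FJ Jx]; exists J => //.
    by have [[_ _ _ h] _] := FP _ FJ; exact: h.
by exists J; split=> // N hN NS JN; exact: maxJ.
Qed.

Lemma ideal_addM A I x : ideal A I -> subring_set A x ->
  ideal A [set y | exists i a, [/\ I i, subring_set A a & y = i + a * x]].
Proof.
move=> [IA I0 ID IM] Ax; split.
- move=> y [i [a [Ii Aa ->]]]; apply: subringD; first exact: IA.
  exact: subringM.
- by exists 0, 0; split=> //; [exact: subring0|rewrite mul0r addr0].
- move=> y z [i [a [Ii Aa ->]]] [j [b [Ij Ab ->]]].
  exists (i + j), (a + b); split; [exact: ID|exact: subringD|ring].
- move=> c y Ac [i [a [Ii Aa ->]]]; exists (c * i), (c * a).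
  by split; [exact: IM|exact: subringM|ring].
Qed.

Lemma prime_avoiding A I (S : set K) : ideal A I -> S 1 ->
  (forall s t, S s -> S t -> S (s * t)) -> (forall x, I x -> ~ S x) ->
  exists P, [/\ prime_ideal A P, I `<=` P & forall x, P x -> ~ S x].
Proof.
move=> hI S1 SM IS; have [P [hP IP PS maxP]] := ideal_maximal_avoiding hI IS.
exists P; split=> //; split=> //; first by move/PS.
have [PA P0 PD PM] := hP.
have meets x : subring_set A x -> ~ P x ->
    exists p a, [/\ P p, subring_set A a & S (p + a * x)].
  move=> Ax Px; apply: contrapT => h.
  apply: Px; rewrite -(maxP _ (ideal_addM hP Ax)).
  - exists 0, 1; split=> //; [exact: subring1|by rewrite add0r mul1r].
  - by move=> y [p [a [Pp Aa ->]]] Sy; apply: h; exists p, a.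
  - move=> p Pp; exists p, 0; split=> //; [exact: subring0|].
    by rewrite mul0r addr0.
move=> x y Ax Ay Pxy; apply: contrapT => /not_orP[Px Py].
have [p [a [Pp Aa Sx]]] := meets x Ax Px.
have [q [b [Pq Ab Sy]]] := meets y Ay Py.
apply: PS (SM _ _ Sx Sy).
(* The product of two elements of [S] is expanded so that every term has a factor p, q or xy lying
   in [P]; thus [P] would meet [S]. *)
rewrite (_ : _ * _ = (q + b * y) * p + (a * x) * q + (a * b) * (x * y)); last by ring.
apply: (PD); first apply: (PD); apply: PM => //.
- by apply: subringD; [exact: PA|exact: subringM].
- exact: subringM.
- exact: subringM.
Qed.

Lemma ideal_sub_maximal A I : ideal A I -> ~ I 1 ->
  exists2 M, maximal_ideal A M & I `<=` M.
Proof.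
move=> hI I1; have [|J [hJ IJ J1 maxJ]] := @ideal_maximal_avoiding A I [set 1] hI.
  by move=> x Ix x1; apply: I1; rewrite -x1.
exists J => //; split=> //; first by move/J1; exact.
by move=> N hN N1 JN; apply: maxJ => // x Nx x1; apply: N1; rewrite -x1.
Qed.

(** The guard [x != 0] puts zero among the nonunits, although [0^-1 = 0] belongs to [R]. *)
Definition nonunits R : set K :=
  [set x | subring_set R x /\ (x != 0 -> ~ subring_set R x^-1)].

Lemma nonunitsP R x : subring_set R x ->
  ~ nonunits R x <-> x != 0 /\ subring_set R x^-1.
Proof.
move=> Rx; split=> [h|[x0 Rx1] [_ /(_ x0)] //].
have x0 : x != 0 by apply: contrapT => /negP; rewrite negbK => /eqP x0;
  apply: h; split=> //; rewrite x0 eqxx.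
by split=> //; apply: contrapT => h'; apply: h; split.
Qed.

Lemma ideal_nonunits R I : ideal R I -> ~ I 1 -> I `<=` nonunits R.
Proof.
move=> [IR _ _ IM] I1 x Ix; split; first exact: IR.
by move=> x0 Rx1; apply: I1; rewrite -(mulVf x0); exact: IM.
Qed.

Lemma local_maximal R M : local R -> maximal_ideal R M -> M = nonunits R.
Proof.
move=> [M0 [hM0 uM0]] hM; apply/seteqP; split.
  by have [hI M1 _] := hM; exact: ideal_nonunits.
move=> x [Rx xV].
(* The principal ideal generated by x, seen as the zero ideal enlarged by x. It is proper because x
   is not a unit, so it lies in the unique maximal ideal. *)
have hI := ideal_addM (I := [set 0]) (A := R) (x := x).
have [||N hN IN] := ideal_sub_maximal (hI _ Rx).
- split=> //; first by move=> _ ->; exact: subring0.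
  + by move=> _ _ -> ->; rewrite addr0.
  + by move=> a _ _ ->; rewrite mulr0.
- move=> [_ [a [-> Ra /esym]]]; rewrite add0r => ax1.
  have x0 : x != 0 by apply/eqP => x0; move: ax1; rewrite x0 mulr0 => /eqP;
    rewrite eq_sym oner_eq0.
  by apply: (xV x0); rewrite -(mulr1 x^-1) -ax1 mulrCA mulVf // mulr1.
rewrite -(uM0 _ hM) (uM0 _ hN); apply: IN; exists 0, 1.
by split=> //; [exact: subring1|rewrite add0r mul1r].
Qed.

Lemma local_nonunits R : local R -> maximal_ideal R (nonunits R).
Proof. by move=> lR; have [M [hM _]] := lR; rewrite -(local_maximal lR hM). Qed.

(** All elements outside [M] are units, and proper ideals contain no unit; hence [M] contains every
    proper ideal. *)
Lemma local_crit R M : ideal R M -> ~ M 1 ->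
  (forall x, subring_set R x -> ~ M x -> x != 0 -> subring_set R x^-1) ->
  local R /\ M = nonunits R.
Proof.
move=> hM M1 MV.
have eM : M = nonunits R.
  apply/seteqP; split; first exact: ideal_nonunits.
  move=> x [Rx xV]; apply: contrapT => Mx; have [x0|x0] := eqVneq x 0.
    by apply: Mx; rewrite x0; have [] := hM.
  by apply: (xV x0); exact: MV.
have maxM : maximal_ideal R M.
  split=> // J hJ J1 MJ; apply/seteqP; split=> //; rewrite eM.
  exact: ideal_nonunits.
split=> //; exists M; split=> // N [hN N1 maxN]; apply: maxN => //.
by rewrite eM; exact: ideal_nonunits.
Qed.

Lemma local_nonunits_prime R : local R -> prime_ideal R (nonunits R).
Proof.
move=> /local_nonunits [hI h1 _]; split=> // x y Rx Ry [_ xyV].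
apply: contrapT => /not_orP[/(nonunitsP Rx) [x0 xV] /(nonunitsP Ry) [y0 yV]].
by apply: xyV; [rewrite mulf_neq0|rewrite invfM; exact: subringM].
Qed.

(** * Localization of a subring of K at a prime ideal *)

Section Localization.
Variables (A : subring K) (P : set K) (hP : prime_ideal A P).

Let PM s t : subring_set A s -> subring_set A t -> ~ P s -> ~ P t -> ~ P (s * t).
Proof. by move=> As At Ps Pt; have [_ _ h] := hP => /(h _ _ As At)[]. Qed.

Lemma prime_neq0 s : ~ P s -> s != 0.
Proof. by move=> Ps; apply/eqP => s0; apply: Ps; rewrite s0; have [[]] := hP. Qed.

Let P1 : ~ P 1. Proof. by have [] := hP. Qed.

Lemma subring_loc_closed : subring_closed [in subring_loc A P].
Proof.
apply: subring_closedP.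
- by exists 1, 1; split; rewrite ?divr1 //; exact: subring1.
- move=> _ _ [a [s [Aa As Ps ->]]] [b [t [Ab At Pt ->]]].
  exists (a * t - b * s), (s * t); split.
  + by apply: subringB; exact: subringM.
  + exact: subringM.
  + exact: PM.
  + by field; rewrite !prime_neq0.
- move=> _ _ [a [s [Aa As Ps ->]]] [b [t [Ab At Pt ->]]].
  exists (a * b), (s * t); split.
  + exact: subringM.
  + exact: subringM.
  + exact: PM.
  + by field; rewrite !prime_neq0.
Qed.

Definition loc : subring K := Subring subring_loc_closed.

Lemma sub_loc : A `<=` loc.
Proof. by move=> a Aa; exists a, 1; split; rewrite ?divr1 //; exact: subring1. Qed.

Lemma locV s : subring_set A s -> ~ P s -> subring_set loc s^-1.
Proof. by move=> As Ps; exists 1, s; split; rewrite ?div1r //; exact: subring1. Qed.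

Lemma loc_invP s : subring_set A s -> s != 0 -> subring_set loc s^-1 <-> ~ P s.
Proof.
move=> As s0; split; last exact: locV.
move=> [a [t [Aa At Pt e]]] Ps.
have t0 := prime_neq0 Pt; apply: Pt.
have -> : t = a * s.
  have : s^-1 * s = a / t * s by rewrite e.
  by rewrite mulVf // => /(congr1 ( *%R^~ t)); rewrite mul1r => ->; field.
by have [[_ _ _ h] _ _] := hP; exact: h.
Qed.

Lemma loc_nonunits s : subring_set A s -> nonunits loc s <-> P s.
Proof.
move=> As; split=> [|Ps]; last first.
  split; first exact: sub_loc.
  by move=> s0 /(loc_invP As s0).
move=> [_ h]; apply: contrapT => Ps.
by apply: (h (prime_neq0 Ps)); exact: locV.
Qed.

Lemma local_loc : local loc.
Proof.
have [[PA P0 PD PX] _ Pprime] := hP.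
have [] // := @local_crit loc
  [set x | exists a s, [/\ P a, subring_set A s, ~ P s & x = a / s]].
- split.
  + by move=> _ [a [s [Pa As Ps ->]]]; exists a, s; split=> //; exact: PA.
  + by exists 0, 1; split; rewrite ?mul0r //; exact: subring1.
  + move=> _ _ [a [s [Pa As Ps ->]]] [b [t [Pb At Pt ->]]].
    exists (t * a + s * b), (s * t); split.
    * by apply: PD; exact: PX.
    * exact: subringM.
    * exact: PM.
    * by field; rewrite !prime_neq0.
  + move=> _ _ [a [s [Aa As Ps ->]]] [b [t [Pb At Pt ->]]].
    exists (a * b), (s * t); split.
    * exact: PX.
    * exact: subringM.
    * exact: PM.
    * by field; rewrite !prime_neq0.
- move=> [a [s [Pa As Ps e]]].
  have s0 := prime_neq0 Ps; apply: Ps; suff -> : s = a by [].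
  by move: e => /(congr1 ( *%R^~ s)); rewrite mul1r divfK.
- move=> _ [a [s [Aa As Ps ->]]] h _; have Pa : ~ P a.
    by move=> Pa; apply: h; exists a, s.
  by exists s, a; split=> //; rewrite invf_div.
Qed.

End Localization.

Lemma prime_contract A B P : prime_ideal B P -> A `<=` B ->
  prime_ideal A (P `&` A).
Proof.
move=> [[_ P0 PD PX] P1 Pprime] AB; split.
- split.
  + exact: subIsetr.
  + by split; [|exact: subring0].
  + by move=> x y [Px Ax] [Py Ay]; split; [exact: PD|exact: subringD].
  + by move=> a x Aa [Px Ax]; split; [apply: PX => //; exact: AB|exact: subringM].
- by move=> [].
- move=> x y Ax Ay [Pxy _].
  by have [h|h] := Pprime _ _ (AB _ Ax) (AB _ Ay) Pxy; [left|right].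
Qed.

Lemma local_center A R : local R -> A `<=` R ->
  prime_ideal A (nonunits R `&` A).
Proof. by move=> /local_nonunits_prime; exact: prime_contract. Qed.

(** For local rings this yields domination of [R] by [S], by [dominatesP]; having no maximal ideal
    in it, it is immediately transitive. *)
Definition unit_reflecting R S : Prop :=
  R `<=` S /\ forall x, subring_set R x -> subring_set S x^-1 -> subring_set R x^-1.

Lemma dominatesP R S : local R -> local S -> unit_reflecting R S -> dominates S R.
Proof.
move=> lR lS [RS RV]; split=> //; exists (nonunits S), (nonunits R).
split; [exact: local_nonunits|exact: local_nonunits|].
apply/seteqP; split=> [x [Rx xV]|x [[_ xV] Rx]].
  by split=> //; split; [exact: RS|move=> x0 /(RV _ Rx); exact: xV].
by split=> // x0 /RS; exact: xV.
Qed.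

Lemma unit_reflecting_refl R : unit_reflecting R R.
Proof. by split. Qed.

Lemma unit_reflecting_trans R S V :
  unit_reflecting R S -> unit_reflecting S V -> unit_reflecting R V.
Proof.
move=> [RS hR] [SV hS]; split; first exact: subset_trans SV.
by move=> x Rx Vx; apply: hR => //; apply: hS => //; exact: RS.
Qed.

(** Elements of [A] outside the center are units of [R], so the fractions lie in [R]. If a/s is a
    unit of [R], so is a, hence a is outside the center and s/a is again a fraction. *)
Lemma loc_center_sub A R (lR : local R) (AR : A `<=` R) :
  unit_reflecting (loc (local_center lR AR)) R.
Proof.
have inR s : subring_set A s -> ~ (nonunits R `&` A) s -> subring_set R s^-1.
  move=> As h; have /(nonunitsP (AR _ As)) [] // : ~ nonunits R s.
  by move=> ?; apply: h.
split=> [_ [a [s [Aa As h ->]]]|_ [a [s [Aa As h ->]]] Rx].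
  by apply: subringM; [exact: AR|exact: inR].
have [a0|a0] := eqVneq a 0.
  by rewrite a0 mul0r invr0; exact: subring0.
rewrite invf_div; exists s, a; split=> // -[[_ /(_ a0) h1] _]; apply: h1.
rewrite (_ : a^-1 = (a / s)^-1 * s^-1).
  by apply: subringM => //; exact: inR.
by rewrite invf_div mulrAC divff ?mul1r // (prime_neq0 (local_center lR AR)).
Qed.

Lemma unit_reflecting_loc A B P Q (hP : prime_ideal A P) (hQ : prime_ideal B Q) :
  A `<=` B -> P = Q `&` A -> unit_reflecting (loc hP) (loc hQ).
Proof.
move=> AB PQ; have notQ s : subring_set A s -> ~ P s -> ~ Q s.
  by move=> As Ps Qs; apply: Ps; rewrite PQ.
split=> [_ [a [s [Aa As Ps ->]]]|_ [a [s [Aa As Ps ->]]] Rx].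
  by exists a, s; split=> //; [exact: AB|exact: AB|exact: notQ].
have [a0|a0] := eqVneq a 0.
  by rewrite a0 mul0r invr0; exact: subring0.
rewrite invf_div; exists s, a; split=> // Pa.
have : subring_set (loc hQ) a^-1.
  rewrite (_ : a^-1 = (a / s)^-1 * s^-1).
    apply: subringM => //; apply: locV; [exact: AB|exact: notQ].
  by rewrite invf_div mulrAC divff ?mul1r // (prime_neq0 hP).
move/(loc_invP hQ (AB _ Aa) a0); apply.
by move: Pa; rewrite PQ => -[].
Qed.

End SubringTheory.

(** * Valuation rings dominating a local subring *)

Section Valuation.
Variable K : fieldType.
Implicit Types (A B R S V : subring K) (P M I J H : set K) (x y a b s t : K).

(* If p(x) = 1 and q(1/x) = 1 with deg q <= deg p, substituting
   x^k = (x^k / (1 - q_0)) (q_1 x^-1 + ...) into the top term of p and clearing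
   the factor 1 - q_0 gives a relation for x of smaller degree. *)
Definition lower_relation (p q : {poly K}) : {poly K} :=
  let k := (size p).-1 in
  \poly_(j < k) ((j == 0)%:R * q`_0 + (1 - q`_0) * p`_j + p`_k * q`_(k - j)).

Lemma lower_relation_horner (p q : {poly K}) x y : x * y = 1 ->
  p.[x] = 1 -> q.[y] = 1 -> (size q <= size p)%N -> (1 < size p)%N ->
  (lower_relation p q).[x] = 1.
Proof.
rewrite /lower_relation => xy px qy; case sp: (size p) => [|[|k]] //= sq _.
rewrite horner_poly.
under eq_bigr => j _ do rewrite mulrDl mulrDl.
(* With d the degree of p, the three sums are q_0, (1 - q_0)(1 - p_d x^d) and p_d x^d (1 - q_0),
   which add up to 1. The last one uses q(y) = 1 multiplied by x^d. *)
rewrite !big_split /=.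
have -> : \sum_(i < k.+1) (i == 0%N :> nat)%:R * q`_0 * x ^+ i = q`_0.
  rewrite big_ord_recl /= mul1r mulr1 big1 ?addr0 // => i _.
  by rewrite !mul0r.
have e1 : \sum_(i < k.+1) (1 - q`_0) * p`_i * x ^+ i =
          (1 - q`_0) * (1 - p`_k.+1 * x ^+ k.+1).
  have -> : 1 - p`_k.+1 * x ^+ k.+1 = \sum_(i < k.+1) p`_i * x ^+ i.
    by rewrite -px horner_coef sp big_ord_recr /= addrK.
  by rewrite mulr_sumr; apply: eq_bigr => i _; rewrite mulrA.
have e2 : \sum_(i < k.+1) p`_k.+1 * q`_(k.+1 - i) * x ^+ i =
          p`_k.+1 * x ^+ k.+1 * (1 - q`_0).
  have -> : 1 - q`_0 = \sum_(i < k.+1) q`_i.+1 * y ^+ i.+1.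
    by rewrite -qy (horner_coef_wide _ sq) big_ord_recl expr0 mulr1 addrC addKr.
  rewrite mulr_sumr (reindex_inj rev_ord_inj) /=.
  apply: eq_bigr => i _; rewrite subSS.
  have -> : (k.+1 - (k - i) = i.+1)%N by have := ltn_ord i; lia.
  have -> : x ^+ k.+1 = x ^+ (k - i) * x ^+ i.+1.
    by rewrite -exprD; congr (_ ^+ _); have := ltn_ord i; lia.
  transitivity (p`_k.+1 * q`_i.+1 * x ^+ (k - i) * (x * y) ^+ i.+1).
    by rewrite xy expr1n mulr1.
  by rewrite exprMn; ring.
by rewrite e1 e2; ring.
Qed.

Variables (V : subring K) (M : set K).
Hypotheses (hM : ideal V M) (M1 : ~ M 1).

Let MV : M `<=` V. Proof. by have [] := hM. Qed.

(** [I] is [M] when the relation being lowered has all coefficients in [M], and [V] when only its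
    constant term is known to lie in [M]. *)
Lemma lower_relation_coef (I : set K) (p q : {poly K}) :
  ideal V I -> M `<=` I -> (forall i, I p`_i) -> M p`_0 ->
  (forall i, subring_set V q`_i) -> M q`_0 ->
  (forall i, (i < (size p).-1)%N -> I (p`_(size p).-1 * q`_i.+1)) ->
  M (p`_(size p).-1 * q`_(size p).-1) ->
  (forall i, I (lower_relation p q)`_i) /\ M (lower_relation p q)`_0.
Proof.
move=> hI MI pI p0 qV q0 pqI pqM; rewrite /lower_relation.
have V1 : subring_set V (1 - q`_0).
  by apply: subringB; [exact: subring1|exact: MV].
have [_ I0 ID IM] := hI; have [_ M0 MD MM] := hM; split=> [i|]; last first.
  rewrite coef_poly; case: ifP => // _; rewrite mul1r subn0.
  by apply: (MD); [apply: (MD)|] => //; exact: MM.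
rewrite coef_poly; case: ifP => // ik; apply: (ID); first apply: (ID).
- apply: IM; last exact: MI.
  by case: eqP => _; [exact: subring1|exact: subring0].
- exact: IM.
- by rewrite -subnSK //; apply: pqI; rewrite ltn_subrL (leq_trans _ ik).
Qed.

(** Descent on the sum of the sizes: lowering the longer relation keeps all memberships, and a
    relation of size at most one would put 1 in [M]. *)
Lemma no_two_relations (p q : {poly K}) x y : x * y = 1 ->
  (forall i, M p`_i) -> (forall i, subring_set V q`_i) -> M q`_0 ->
  p.[x] = 1 -> q.[y] = 1 -> False.
Proof.
move: {2}(size p + size q)%N (leqnn (size p + size q)) => n.
elim: n p q => [|n IH] p q spq xy pM qV q0 px qy.
  move: px; have -> : p = 0 by apply/eqP; rewrite -size_poly_eq0; lia.
  by rewrite horner0 => /eqP; rewrite eq_sym oner_eq0.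
have yx : y * x = 1 by rewrite mulrC.
have MM a b : subring_set V a -> M b -> M (a * b) by have [_ _ _] := hM; apply.
have hV : ideal V V.
  split=> //; [exact: subring0|exact: subringD|exact: subringM].
have const (r : {poly K}) z : (size r <= 1)%N -> M r`_0 -> r.[z] = 1 -> False.
  by move=> /size1_polyC ->; rewrite coefC hornerC /= => + r1; rewrite r1.
have [p1|p1] := leqP (size p) 1; first exact: const p1 (pM 0) px.
have [q1|q1] := leqP (size q) 1; first exact: const q1 q0 qy.
have lower (r r' : {poly K}) : (1 < size r)%N -> (size (lower_relation r r') < size r)%N.
  by move=> r1; rewrite (leq_ltn_trans (size_poly _ _)) //; lia.
have [qp|pq] := leqP (size q) (size p).
- have [||||||||p'M _] := @lower_relation_coef M p q => //.
  + by move=> i _; rewrite mulrC; exact: MM.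
  + by rewrite mulrC; exact: MM.
  apply: (IH (lower_relation p q) q) => //; first by have := lower p q p1; lia.
  exact: lower_relation_horner xy px qy qp p1.
- have [||||||||q'V q'M] := @lower_relation_coef V q p => //.
  + by move=> i; exact: MV.
  + by move=> i _; apply: subringM => //; exact: MV.
  + exact: MM.
  apply: (IH p (lower_relation q p)) => //; first by have := lower q p q1; lia.
  exact: lower_relation_horner yx qy px (ltnW pq) q1.
Qed.

Hypothesis maxM : forall B N, ideal B N -> ~ N 1 -> V `<=` B -> M `<=` N ->
  B `<=` V /\ N `<=` M.

(* The pair formed by V[x] and the values at x of the polynomials below cannot
   extend the maximal pair (V, M) unless it is contained in it. It is applied
   with I = M, giving M V[x], and with I = V, giving M + x V[x]. *)
Lemma relation_of_notin (I : set K) x : ideal V I -> M `<=` I ->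
  (subring_set V x /\ (I 1 -> M x)) \/
  exists p : {poly K}, [/\ forall i, I p`_i, M p`_0 & p.[x] = 1].
Proof.
move=> hI MI.
have [IV I0 ID IM] := hI; have [_ M0 MD MM] := hM.
pose N : set K := [set y | exists p : {poly K},
  [/\ forall i, I p`_i, M p`_0 & p.[x] = y]].
have [[p [pI p0 px]]|N1] := pselect (N 1); first by right; exists p.
left.
have N0 : N 0 by exists 0; split; rewrite ?horner0 ?coef0 // => i; rewrite coef0.
have ND y z : N y -> N z -> N (y + z).
  move=> [p [pI p0 <-]] [q [qI q0 <-]]; exists (p + q); split.
  - by move=> i; rewrite coefD; exact: ID.
  - by rewrite coefD; exact: MD.
  - by rewrite hornerD.
have NZ a y : subring_set V a -> N y -> N (a * y).
  move=> Va [p [pI p0 <-]]; exists (a *: p); split.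
  - by move=> i; rewrite coefZ; exact: IM.
  - by rewrite coefZ; exact: MM.
  - by rewrite hornerZ.
have NX y : N y -> N (x * y).
  move=> [p [pI p0 <-]]; exists (p * 'X); split.
  - by case=> [|i]; rewrite coefMX /=.
  - by rewrite coefMX /=.
  - by rewrite hornerMX mulrC.
(* The idealizer of [N] replaces V[x]: it contains [V] and x, and [N] is an ideal of it as soon as
   it contains [N]. *)
have idealizer_closed :
    subring_closed [in [set a : K | forall y, N y -> N (a * y)]].
  apply: subring_closedP => [y|a b ha hb y Ny|a b ha hb y Ny] /=.
  - by rewrite mul1r.
  - rewrite mulrBl; apply: ND; first exact: ha.
    rewrite -mulN1r; apply: NZ; last exact: hb.
    by apply: subringN; exact: subring1.
  - by rewrite -mulrA; apply: ha; exact: hb.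
pose B := Subring idealizer_closed.
have VB : V `<=` B by move=> a Va y; exact: NZ.
have Bx : subring_set B x by exact: NX.
have NB : N `<=` B.
  move=> _ [p [pI _ <-]]; have {}pI i : subring_set V p`_i by exact: IV.
  elim/poly_ind: p pI => [|p c IH] pI.
    by rewrite horner0; exact: subring0.
  rewrite hornerMXaddC; apply: subringD.
    apply: subringM => //; apply: IH => i; have := pI i.+1.
    by rewrite coefD coefMX coefC addr0.
  by apply: VB; have := pI 0; rewrite coefD coefMX coefC add0r.
have MN : M `<=` N.
  move=> m Mm; exists m%:P; split; rewrite ?hornerC ?coefC //.
  by move=> i; rewrite coefC; case: eqP => // _; exact: MI.
have hN : ideal B N by split=> // a y Ba Ny; exact: Ba.
have [BV NM] := maxM hN N1 VB MN.
split; first exact: BV.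
(* The polynomial ['X] has a coefficient 1, so it is admissible exactly because 1 is in [I]; its
   value is x. *)
move=> I1; apply: NM; exists 'X; split; rewrite ?hornerX ?coefX // => i.
by rewrite coefX; case: eqP.
Qed.

(** If x is not in [V] there is a relation at x with coefficients in [M]; if y is not in [M] there
    is one at y over [V] with constant term in [M]. Both together are impossible. *)
Lemma maximal_pair_dichotomy x y : x * y = 1 -> subring_set V x \/ M y.
Proof.
move=> xy; have hV : ideal V V.
  split=> //; [exact: subring0|exact: subringD|exact: subringM].
have [[Vx _]|[p [pM _ px]]] := relation_of_notin x hM (@subset_refl _ M).
  by left.
have [[_ h]|[q [qV q0 qy]]] := relation_of_notin y hV MV.
  by right; apply: h; exact: subring1.
by have := no_two_relations xy pM qV q0 px qy.
Qed.

End Valuation.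

(** Chevalley's theorem. A maximal pair (V, M) above R and its nonunits satisfies the dichotomy for
    x and its inverse, which makes [V] at once a valuation ring and a local ring with maximal ideal
    [M]. *)
Lemma exists_valuation_ring (K : fieldType) (R : subring K) : local R ->
  exists V, [/\ valuation_ring V, local V & unit_reflecting R V].
Proof.
move=> lR; have [hR R1 _] := local_nonunits lR.
(* Zorn on pairs (B, N) with N a proper ideal of the subring B, a pair being
   encoded as a subset of bool * K. *)
pose ring_part (J : set (bool * K)) : set K := [set x | J (true, x)].
pose ideal_part (J : set (bool * K)) : set K := [set x | J (false, x)].
pose pair (A I : set K) : set (bool * K) := [set u | if u.1 then A u.2 else I u.2].
pose valid J := exists2 B : subring K, B = ring_part J :> set K
  & ideal B (ideal_part J) /\ ~ J (false, 1).
have valid_pair (B : subring K) I : ideal B I -> ~ I 1 -> valid (pair B I).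
  by move=> hI I1; exists B.
have [||J [[V VJ [hM M1]] RJ maxJ]] := @Zorn_above _ valid (pair R (nonunits R)).
- exact: valid_pair.
- move=> F [J0 FJ0] FP totF.
  have tot2 u v : (\bigcup_(J in F) J) u -> (\bigcup_(J in F) J) v ->
      exists J, [/\ F J, J u & J v].
    move=> [J FJ Ju] [L FL Lv].
    have [h|h] := totF _ _ FJ FL; [exists L|exists J]; split=> //; exact: h.
  have cl : subring_closed [in ring_part (\bigcup_(J in F) J)].
    apply: subring_closedP.
    + exists J0 => //; have [B BJ _] := FP _ FJ0.
      by have := subring1 B; rewrite BJ.
    + move=> x y hx hy; have [J [FJ Jx Jy]] := tot2 _ _ hx hy.
      have [B BJ _] := FP _ FJ; exists J => //.
      by have := @subringB _ B x y; rewrite BJ; apply.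
    + move=> x y hx hy; have [J [FJ Jx Jy]] := tot2 _ _ hx hy.
      have [B BJ _] := FP _ FJ; exists J => //.
      by have := @subringM _ B x y; rewrite BJ; apply.
  exists (Subring cl) => //; split; last first.
    by move=> [J /FP [B _ [_ h]]].
  split.
  + move=> x [J FJ Jx]; exists J => //; have [B BJ [[h _ _ _] _]] := FP _ FJ.
    by have := h x Jx; rewrite BJ.
  + by exists J0 => //; have [B BJ [[_ h _ _] _]] := FP _ FJ0.
  + move=> x y hx hy; have [J [FJ Jx Jy]] := tot2 _ _ hx hy.
    have [B BJ [[_ _ h _] _]] := FP _ FJ; exists J => //.
    exact: h.
  + move=> a x ha hx; have [J [FJ Ja Jx]] := tot2 _ _ ha hx.
    have [B BJ [[_ _ _ h] _]] := FP _ FJ; exists J => //.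
    by apply: h => //; rewrite BJ.
set M := ideal_part J in hM.
have maxM (B : subring K) N : ideal B N -> ~ N 1 -> V `<=` B -> M `<=` N ->
    B `<=` V /\ N `<=` M.
  move=> hN N1 VB MN.
  have eJ : pair B N = J.
    apply: maxJ; first exact: valid_pair.
    move=> [[] x] Jx /=; last exact: MN.
    by apply: VB; rewrite VJ.
  by split=> x; [rewrite VJ /ring_part -eJ|rewrite /M /ideal_part -eJ].
have dich := maximal_pair_dichotomy hM M1 maxM.
have MV : M `<=` V by have [] := hM.
have RV : R `<=` V by move=> x Rx; rewrite VJ; apply: RJ.
have [lV eM] : local V /\ M = nonunits V.
  apply: local_crit => // x Vx Mx x0.
  by have [//|] := dich x^-1 x (mulVf x0).
exists V; split=> //.
  move=> x x0; have [|/MV] := dich x x^-1 (mulfV x0); [by left|by right].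
split=> // x Rx Vx; apply: contrapT => Rx1.
have x0 : x != 0.
  by apply/eqP => x0; apply: Rx1; rewrite x0 invr0; exact: subring0.
(* A nonunit of [R] stays in [M], the set of nonunits of [V], so [V] cannot invert it. *)
have : M x by apply: RJ; split.
by rewrite eM => -[_ /(_ x0)].
Qed.

(** * Affine patches and quasi-compactness *)

Section FiniteCovers.
Variables (T : Type) (I : choiceType) (D : set I) (f : I -> set T).

Lemma finite_subset_cover0 : finite_subset_cover D f set0.
Proof. by exists fset0. Qed.

Lemma finite_subset_cover1 (A : set T) i : D i -> A `<=` f i ->
  finite_subset_cover D f A.
Proof.
move=> Di Ai; exists [fset i]%fset; first by move=> j /[!inE] /eqP ->; exact: mem_set.
by move=> x /Ai fx; exists i => //=; rewrite inE.
Qed.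

Lemma finite_subset_coverU (A B : set T) : finite_subset_cover D f A ->
  finite_subset_cover D f B -> finite_subset_cover D f (A `|` B).
Proof.
move=> [I1 h1 A1] [I2 h2 B2]; exists (I1 `|` I2)%fset.
  by move=> i /[!inE] /orP[/h1|/h2].
by move=> x [/A1|/B2] [i /= ii fx]; exists i => //=; rewrite inE ii ?orbT.
Qed.

Lemma finite_subset_cover_sub (A B : set T) : A `<=` B ->
  finite_subset_cover D f B -> finite_subset_cover D f A.
Proof. by move=> AB [J DJ BJ]; exists J => //; exact: subset_trans BJ. Qed.

End FiniteCovers.

Lemma cover_compact_bigcup (T : topologicalType) (I : choiceType) (J : {fset I})
    (A : I -> set T) : (forall i, i \in J -> cover_compact (A i)) ->
  cover_compact (\bigcup_(i in [set` J]) A i).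
Proof.
move=> hA L D f fop; have -> : [set` J] = [set` enum_fset J] by [].
have : forall i, i \in enum_fset J -> cover_compact (A i) by [].
elim: (enum_fset J) => [|i s IH] {}hA cov.
  apply: finite_subset_cover_sub (finite_subset_cover0 D f).
  by move=> x [i].
apply: (@finite_subset_cover_sub _ _ _ _ _
  (A i `|` \bigcup_(i in [set` s]) A i)).
  by move=> x [j /= /[!inE] /predU1P[->|sj] Ax]; [left|right; exists j].
apply: finite_subset_coverU.
  apply: hA => //; first exact: mem_head.
  by move=> x Ax; apply: cov; exists i => //=; exact: mem_head.
apply: IH => [j js|x [j js Ax]]; first by apply: hA; rewrite inE js orbT.
by apply: cov; exists j => //=; rewrite inE; apply/orP; right.
Qed.

(** * Affine patches of an irredundant set and their joins *)

Section AffinePatches.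
Variables (K : fieldType).
Implicit Types (A B C R S : subring K) (X : set (subring K)) (P H : set K).
Implicit Types (a s h : K).

Lemma localizationsP A R :
  localizations A R <-> exists P (hP : prime_ideal A P), R = loc hP.
Proof.
split=> [[P hP e]|[P [hP ->]]]; last by exists P.
by exists P, hP; exact: subring_eq.
Qed.

Definition full_subring : subring K :=
  @Subring K setT (@subring_closedP K setT I (fun _ _ _ _ => I) (fun _ _ _ _ => I)).

Lemma zero_prime A : prime_ideal A [set 0].
Proof.
split.
- split=> //; first by move=> _ ->; exact: subring0.
  + by move=> _ _ -> ->; rewrite addr0.
  + by move=> a _ _ ->; rewrite mulr0.
- by apply/eqP; exact: oner_neq0.
- by move=> x y _ _ /eqP; rewrite mulf_eq0 => /orP[/eqP|/eqP]; [left|right].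
Qed.

(** The localization at zero is a field, and a field is its own fraction field. *)
Lemma loc_zero_full A : has_fraction_field (loc (zero_prime A)) ->
  loc (zero_prime A) = full_subring.
Proof.
move=> frac; apply: subring_eq; apply/seteqP; split=> // x _.
have [a [b [La [c [s [Ac As s0 eb]]] b0 ->]]] := frac x.
apply: subringM => //; rewrite eb invf_div; exists s, c; split=> // c0.
by move: b0; rewrite eb c0 mul0r eqxx.
Qed.

Definition affine_patch X A : Prop :=
  forall R, localizations A R <-> X R /\ A `<=` R.

Lemma irredundant_local X R S (T : subring K) :
  irredundant X -> (forall R, X R -> local R) ->
  X R -> X S -> local T -> unit_reflecting R T -> unit_reflecting S T -> R = S.
Proof.
move=> irr XL XR XS lT RT ST; have [V [vV lV TV]] := exists_valuation_ring lT.
by apply: (irr R S V XR XS vV); apply: dominatesP => //; try exact: XL;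
  exact: unit_reflecting_trans TV.
Qed.

Section Irredundant.
Variables (X : set (subring K)) (irrX : irredundant X)
  (locX : forall R, X R -> local R).

(** Given [R] in [X] above [A], the localization of [A] at the center of [R] is also in [X]. Both
    are dominated by [R] itself, so they coincide. *)
Lemma affine_patch_sub A : localizations A `<=` X -> affine_patch X A.
Proof.
move=> AX R; split=> [AR|[XR AR]].
  split; first exact: AX.
  by have /localizationsP[P [hP ->]] := AR; exact: sub_loc.
have lR := locX XR; apply/localizationsP.
exists (nonunits R `&` A), (local_center lR AR).
apply: (irredundant_local irrX locX XR _ lR) => //.
- by apply: AX; apply/localizationsP; exists (nonunits R `&` A), (local_center lR AR).
- exact: unit_reflecting_refl.
- exact: loc_center_sub.
Qed.

(** The localization of [C] at [P] dominates those of [A] and [B] at the contractions of [P]. These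
    two are therefore equal, contain [A] and [B] and hence [C], and reflect units; so they are all
    of C_P. Conversely a member of [X] above [C] is already a localization of [A]. *)
Lemma affine_patch_join A B C : affine_patch X A -> affine_patch X B ->
  A `<=` C -> B `<=` C -> (forall R, A `<=` R -> B `<=` R -> C `<=` R) ->
  affine_patch X C.
Proof.
move=> hA hB AC BC ABC R; split=> [/localizationsP[P [hP ->]]|[XR CR]].
  pose LA := loc (prime_contract hP AC); pose LB := loc (prime_contract hP BC).
  have [XA _] : X LA /\ A `<=` LA.
    by apply/hA/localizationsP; exists (P `&` A), (prime_contract hP AC).
  have [XB _] : X LB /\ B `<=` LB.
    by apply/hB/localizationsP; exists (P `&` B), (prime_contract hP BC).
  have uA : unit_reflecting LA (loc hP) by exact: unit_reflecting_loc.
  have uB : unit_reflecting LB (loc hP) by exact: unit_reflecting_loc.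
  have LAB : LA = LB := irredundant_local irrX locX XA XB (local_loc hP) uA uB.
  have CL : C `<=` LA.
    by apply: ABC; [exact: sub_loc|rewrite LAB; exact: sub_loc].
  suff <- : LA = loc hP by split.
  apply: subring_eq; apply/seteqP; split; first by have [] := uA.
  move=> _ [a [s [Ca Cs Ps ->]]]; apply: subringM; first exact: CL.
  by have [_ h] := uA; apply: h; [exact: CL|exact: locV].
have lR := locX XR; apply/localizationsP.
exists (nonunits R `&` C), (local_center lR CR).
apply: subring_eq; apply/seteqP; split; last first.
  by have [] := loc_center_sub lR CR.
have /localizationsP[Q [hQ eR]] : localizations A R.
  by apply/hA; split=> //; exact: subset_trans CR.
move=> x; rewrite {1}eR => -[a [s [Aa As Qs ->]]].
exists a, s; split; [exact: AC|exact: AC| |by []].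
move=> [[_ h] _]; apply: (h (prime_neq0 hQ Qs)).
by rewrite eR; exact: locV.
Qed.

Definition subring_join A B : subring K :=
  subring_bigcap [set R : subring K | A `<=` R /\ B `<=` R] id.

Lemma sub_joinl A B : A `<=` subring_join A B.
Proof. by move=> x Ax R [AR _]; exact: AR. Qed.

Lemma sub_joinr A B : B `<=` subring_join A B.
Proof. by move=> x Bx R [_ BR]; exact: BR. Qed.

Lemma join_sub A B R : A `<=` R -> B `<=` R -> subring_join A B `<=` R.
Proof. by move=> AR BR x; apply. Qed.

End Irredundant.

(** The product of the denominators works because [H] is finite. *)
Lemma common_denominator A P H : prime_ideal A P -> finite_set H ->
  H `<=` subring_loc A P ->
  exists s, [/\ subring_set A s, ~ P s & forall x, H x -> subring_set A (x * s)].
Proof.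
move=> hP /finite_seqP [r ->]; elim: r => [|x r IH] rP.
  by exists 1; split; [exact: subring1|have [] := hP|].
have [s [As Ps rs]] := IH (fun y yr => rP y (mem_behead (s := x :: r) yr)).
have [a [t [Aa At Pt ex]]] := rP x (mem_head x r).
have t0 := prime_neq0 hP Pt.
exists (t * s); split; [exact: subringM| |].
  by have [_ _ h] := hP => /(h _ _ At As)[].
move=> y /= /[!inE] /predU1P[->|yr].
  by rewrite ex mulrA divfK //; exact: subringM.
by rewrite mulrCA; apply: subringM => //; exact: rs.
Qed.

End AffinePatches.

(** * Principal open sets, quasi-compactness and quasi-separatedness *)

Section Topology.
Variables (K : fieldType) (X : set (subring K)).
Implicit Types (A B R : subring K) (x : zariski_space X) (W : set (zariski_space X)).
Implicit Types (H : set K) (h s : K).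

Lemma zariski_ringP x : X (zariski_ring x).
Proof. exact: set_valP. Qed.

Lemma open_zariski_basis H : finite_set H -> open (@zariski_basis K X H).
Proof.
move=> fH; exists [set H]; first by move=> _ ->.
by rewrite bigcup_set1.
Qed.

Lemma open_zariski_nbhd W x : open W -> W x ->
  exists H, [/\ finite_set H, zariski_basis H x & zariski_basis H `<=` W].
Proof.
move=> [F fF <-] [H FH Hx]; exists H; split=> //; first exact: fF.
by move=> y Hy; exists H.
Qed.

Definition overrings A : set (zariski_space X) := [set x | A `<=` zariski_ring x].

(** The counterpart of the principal open set D(h) of Spec A. The condition [h != 0] makes it empty
    for h = 0. *)
Definition unit_locus A h : set (zariski_space X) :=
  [set x | [/\ A `<=` zariski_ring x, h != 0
    & subring_set (zariski_ring x) h^-1]].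

Lemma unit_locus_sub A h : unit_locus A h `<=` overrings A.
Proof. by move=> x []. Qed.

Lemma unit_locus1 A : unit_locus A 1 = overrings A.
Proof.
apply/seteqP; split=> [|x Ax]; first exact: unit_locus_sub.
by split=> //; [exact: oner_neq0|rewrite invr1; exact: subring1].
Qed.

Lemma open_unit_locus A h : open (overrings A) -> open (unit_locus A h).
Proof.
move=> oA; have [->|h0] := eqVneq h 0.
  suff -> : unit_locus A 0 = set0 by exact: open0.
  by apply/seteqP; split=> // x []; rewrite eqxx.
suff -> : unit_locus A h = overrings A `&` zariski_basis [set h^-1].
  by apply: openI => //; exact: open_zariski_basis.
apply/seteqP; split=> [x [Ax _ hx]|x [Ax hx]]; split=> //.
  by move=> _ ->.
exact: hx.
Qed.

(** The inverse of one factor is the inverse of the product times the other factor. Principal open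
    sets of two patches thus meet in a principal open set of the joined patch. *)
Lemma unit_locusI A B h h' : subring_set A h -> subring_set B h' ->
  unit_locus A h `&` unit_locus B h' = unit_locus (subring_join A B) (h * h').
Proof.
move=> Ah Bh; apply/seteqP; split=> x.
  move=> [[Ax h0 hx] [Bx h'0 h'x]]; split.
  - exact: join_sub.
  - by rewrite mulf_neq0.
  - by rewrite invfM; exact: subringM.
move=> [Cx]; rewrite mulf_eq0 => /norP[h0 h'0] hhx.
have Ax := subset_trans (@sub_joinl _ A B) Cx.
have Bx := subset_trans (@sub_joinr _ A B) Cx.
split; split=> //.
  rewrite (_ : h^-1 = (h * h')^-1 * h'); last by rewrite invfM divfK.
  by apply: subringM => //; exact: Bx.
rewrite (_ : h'^-1 = (h * h')^-1 * h); last by rewrite invfM mulrAC mulVf ?mul1r.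
by apply: subringM => //; exact: Ax.
Qed.

Lemma loc_unit_locus A h x P (hP : prime_ideal A P) :
  zariski_ring x = loc hP -> subring_set A h -> unit_locus A h x <-> ~ P h.
Proof.
move=> ex Ah; rewrite /unit_locus /= ex; split=> [[_ h0]|Ph].
  by move/(loc_invP hP Ah h0).
split; [exact: sub_loc|exact: (prime_neq0 hP Ph)|exact: locV].
Qed.

(** Take s to be a common denominator of a finite [H] defining a basic neighbourhood: wherever s is
    a unit, each a in [H] is recovered as (a s)/s. *)
Lemma unit_locus_nbhd A W x : affine_patch X A -> open W -> W x -> overrings A x ->
  exists s, [/\ subring_set A s, unit_locus A s x & unit_locus A s `<=` W].
Proof.
move=> hA oW Wx Ax; have [H [fH Hx HW]] := open_zariski_nbhd oW Wx.
have /localizationsP[P [hP ex]] : localizations A (zariski_ring x).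
  by apply/hA; split=> //; exact: zariski_ringP.
have HP : H `<=` loc hP by rewrite -ex.
have [s [As Ps sH]] := common_denominator hP fH HP.
exists s; split=> //; first exact/(loc_unit_locus ex As).
move=> y [Ay s0 sy]; apply: HW => a Ha.
have := subringM (Ay _ (sH a Ha)) sy.
by rewrite mulfK.
Qed.

Lemma unit_locus_cover_compact A h : affine_patch X A -> subring_set A h ->
  cover_compact (unit_locus A h).
Proof.
move=> hA Ah I D f fop cov.
(* The a such that the points where a and h are units are finitely covered form
   an ideal; a prime above it avoiding h would be a point that is not covered. *)
pose J : set K := [set a | subring_set A a /\
  finite_subset_cover D f (unit_locus A a `&` unit_locus A h)].
have hJ : ideal A J.
  split.
  - by move=> a [].
  - split; first exact: subring0.
    apply: finite_subset_cover_sub (finite_subset_cover0 D f).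
    by move=> x [[_]]; rewrite eqxx.
  - move=> a b [Aa Ja] [Ab Jb]; split; first exact: subringD.
    apply: finite_subset_cover_sub (finite_subset_coverU Ja Jb).
    move=> x [abx hx]; rewrite -setIUl; split=> //.
    have [Ax _ _] := hx.
    have /localizationsP[P [hP ex]] : localizations A (zariski_ring x).
      by apply/hA; split=> //; exact: zariski_ringP.
    move/(loc_unit_locus ex (subringD Aa Ab)) : abx => Pab.
    apply: contrapT => /not_orP[]; rewrite !(loc_unit_locus ex) //.
    move=> /contrapT Pa /contrapT Pb; apply: Pab.
    by have [[_ _ PD _] _ _] := hP; exact: PD.
  - move=> c a Ac [Aa Ja]; split; first exact: subringM.
    apply: finite_subset_cover_sub Ja; apply: setSI => x cax.
    have [Ax _ _] := cax.
    have /localizationsP[P [hP ex]] : localizations A (zariski_ring x).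
      by apply/hA; split=> //; exact: zariski_ringP.
    move/(loc_unit_locus ex (subringM Ac Aa)) : cax => Pca.
    apply/(loc_unit_locus ex Aa) => Pa; apply: Pca.
    by have [[_ _ _ PM] _ _] := hP; exact: PM.
apply: contrapT => nfin.
have powA n : subring_set A (h ^+ n).
  elim: n => [|n IH]; first exact: subring1.
  by rewrite exprS; exact: subringM.
have [|||P [hP JP PS]] := @prime_avoiding _ A J (range (fun n => h ^+ n)) hJ.
- by exists 0; rewrite // expr0.
- by move=> _ _ [m _ <-] [n _ <-]; exists (m + n)%N; rewrite // exprD.
(* A power of h in [J] would give a finite cover of the whole locus of h, since powers of h are
   units there. *)
- move=> x [_ Jn] [n _ en]; apply: nfin; apply: finite_subset_cover_sub Jn.
  move=> y hy; split=> //; have [Ay h0 hVy] := hy.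
  rewrite -en; split=> //; first by rewrite expf_neq0.
  rewrite -exprVn; elim: n {en} => [|n IH]; first exact: subring1.
  by rewrite exprS; exact: subringM.
have [XP AP] : X (loc hP) /\ A `<=` loc hP.
  by apply/hA/localizationsP; exists P, hP.
pose x : zariski_space X := SigSub (mem_set XP).
have ex : zariski_ring x = loc hP by [].
have hx : unit_locus A h x.
  apply/(loc_unit_locus ex Ah) => Ph; apply: (PS _ Ph).
  by exists 1; rewrite ?expr1.
have [i Di fix_] := cov x hx.
have [s [As sx sf]] := unit_locus_nbhd hA (fop i Di) fix_ AP.
(* The locus of s lies in one member of the cover, so s is in [J] and hence in [P], although s is a
   unit at x. *)
move/(loc_unit_locus ex As) : sx; apply; apply: JP; split=> //.
by apply: finite_subset_cover1 Di _ => y [sy _]; exact: sf.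
Qed.

Section Cover.
Variables (irrX : irredundant X)
  (locX : forall R, X R -> local R).
Variables (n : nat) (E : 'I_n -> subring K).
Hypothesis patchE : forall i, affine_patch X (E i).
Hypothesis openE : forall i, open (overrings (E i)).
Hypothesis coverE : forall x, exists i, overrings (E i) x.

Lemma zariski_quasi_compact : quasi_compact (zariski_space X).
Proof.
rewrite /quasi_compact.
rewrite (_ : [set: _] = \bigcup_(i in [set` [fset i | i in 'I_n]%fset]) overrings (E i)).
  apply: cover_compact_bigcup => i _; rewrite -unit_locus1.
  by apply: unit_locus_cover_compact => //; exact: subring1.
apply/seteqP; split=> // x _; have [i Ex] := coverE x; exists i => //=.
by apply/imfsetP; exists i.
Qed.

Lemma open_compact_unit_loci U : open U -> cover_compact U ->
  exists J : {fset 'I_n * K}, (forall u, u \in J -> subring_set (E u.1) u.2) /\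
    U = \bigcup_(u in [set` J]) unit_locus (E u.1) u.2.
Proof.
move=> oU cU.
have [||J DJ UJ] := cU _ [set u : 'I_n * K | subring_set (E u.1) u.2 /\
    unit_locus (E u.1) u.2 `<=` U] (fun u => unit_locus (E u.1) u.2).
- by move=> u _; exact: open_unit_locus.
- move=> x Ux; have [i Ex] := coverE x.
  have [s [Es sx sU]] := unit_locus_nbhd (patchE i) oU Ux Ex.
  by exists (i, s).
exists J; split; first by move=> u /DJ /set_mem [].
apply/seteqP; split=> // x [u uJ].
by have /set_mem[_] := DJ u uJ; exact.
Qed.

Lemma zariski_quasi_separated : quasi_separated (zariski_space X).
Proof.
move=> U V oU oV /(open_compact_unit_loci oU) [J [JE ->]].
move=> /(open_compact_unit_loci oV) [L [LE ->]].
rewrite (_ : _ `&` _ = \bigcup_(u in [set` J]) \bigcup_(v in [set` L])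
    unit_locus (subring_join (E u.1) (E v.1)) (u.2 * v.2)).
  apply: cover_compact_bigcup => u uJ; apply: cover_compact_bigcup => v vL.
  apply: unit_locus_cover_compact.
    by apply: affine_patch_join (patchE u.1) (patchE v.1) _ _ _ => //;
      [exact: sub_joinl|exact: sub_joinr|move=> R; exact: join_sub].
  apply: subringM; [apply: sub_joinl; exact: JE|apply: sub_joinr; exact: LE].
apply/seteqP; split=> x.
  move=> [[u uJ ux] [v vL vx]]; exists u => //; exists v => //.
  by rewrite -unit_locusI //; [exact: JE|exact: LE].
move=> [u uJ [v vL]]; rewrite -unit_locusI; [|exact: JE|exact: LE].
by move=> [ux vx]; split; [exists u|exists v].
Qed.

End Cover.
End Topology.

Lemma model_affine_cover (K : fieldType) (D : subring K) (X : set (subring K)) :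
  model D X -> exists (n : nat) (E : 'I_n -> subring K),
    [/\ forall i, affine_patch X (E i), forall i, open (overrings (X := X) (E i))
      & forall x : zariski_space X, exists i, overrings (E i) x].
Proof.
move=> [[_ XL] irrX [n [E [aE eX]]]].
have locX R : X R -> local R by move=> /XL[].
have patchE i : affine_patch X (E i).
  by apply: affine_patch_sub => // R ER; rewrite eX; exists i.
exists n, E; split=> // [i|x].
  have [H fH eE] := aE i.
  (* Every member of [X] contains [D], so containing [E i] amounts to containing its finitely many
     generators, which is a basic open condition. *)
  suff -> : overrings (E i) = @zariski_basis K X H.
    exact: open_zariski_basis.
  apply/seteqP; split=> x.
    by move=> Ex a Ha; apply: Ex; rewrite eE => B [_ DHB]; apply: DHB; right.
  move=> Hx a; rewrite eE; apply; split; first exact: subringP.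
  have [Dx _ _] := XL _ (zariski_ringP x).
  by move=> b [/Dx|/Hx].
have : X (zariski_ring x) := zariski_ringP x.
by rewrite {1}eX => -[i _ Ei]; exists i; have [] := (patchE i _).1 Ei.
Qed.

(** * Sections, stalks and the generic point *)

(** Meant for stalks, whose evaluation in K goes through representatives; hence a bare function with
    the morphism laws as hypotheses. Elements of [B] mapped to units of [R] are units, so proper
    ideals map into the nonunits. *)
Lemma local_embedding (K : fieldType) (R : subring K) (B : comPzRingType)
    (f : B -> K) : local R -> injective f ->
  f 1 = 1 -> {morph f : a b / a + b} -> {morph f : a b / a * b} ->
  (forall b, subring_set R (f b)) -> (forall r, subring_set R r -> exists b, f b = r) ->
  local [set: B].
Proof.
move=> lR finj f1 fD fM fR Rf.
have [[_ N0 ND NM] N1 _] := local_nonunits lR.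
have f0 : f 0 = 0 by apply: (addrI (f 0)); rewrite -fD !addr0.
pose M : set B := [set b | nonunits R (f b)].
have hM : ideal setT M.
  split=> //; rewrite /M /=.
  - by rewrite f0.
  - by move=> a b; rewrite fD; exact: ND.
  - by move=> a b _; rewrite fM; apply: NM.
have M1 : ~ M 1 by rewrite /M /= f1.
have sub J : ideal setT J -> ~ J 1 -> J `<=` M.
  move=> [_ _ _ JM] J1 b Jb; split=> // b0 /Rf[c cb]; apply: J1.
  have -> : 1 = c * b by apply: finj; rewrite fM cb mulVf.
  exact: JM.
exists M; split.
  by split=> // J hJ J1 MJ; apply/seteqP; split=> //; exact: sub.
by move=> J [hJ J1 maxJ]; apply: maxJ => //; exact: sub.
Qed.

Section Sections.
Variables (K : fieldType) (X : set (subring K)).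
Local Notation F := (zariski_presheaf X).
Implicit Types (U V : opens (zariski_space X)) (x : zariski_space X) (a : K).

(** The value 0 on the zero ring keeps sums and products compatible with values over the empty set
    as well. *)
Definition guarded_val (P : Prop) (d : {P} + {~ P}) (A : subring K) :
    guarded d A -> K :=
  match d return guarded d A -> K with
  | left _ => fun z : subring_type A => val z
  | right _ => fun _ => 0
  end.

Definition sect_val U (s : F U) : K := guarded_val s.

Lemma sect_val_inj U : (U : set _) !=set0 -> injective (@sect_val U).
Proof.
by rewrite /sect_val /= /zariski_sect; case: pselect.
Qed.

Lemma sect_empty U (s t : F U) : ~ ((U : set _) !=set0) -> s = t.
Proof. by move: s t; rewrite /= /zariski_sect; case: pselect => // p [] []. Qed.

Lemma sect_valP U (s : F U) x :
  opens_set U x -> subring_set (zariski_ring x) (sect_val s).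
Proof.
move=> Ux; have Un : (U : set _) !=set0 by exists x.
move: s; rewrite /sect_val /= /zariski_sect; case: pselect => // p s.
by have /set_mem := valP s; apply.
Qed.

Lemma sect_val_res U V (VU : V `<=` U) (s : F U) : (V : set _) !=set0 ->
  sect_val (res F VU s) = sect_val s.
Proof.
move=> Vn; have Un := subset_nonempty VU Vn.
move: s; rewrite /sect_val /= /zariski_sect /zariski_res /guarded_res /=.
by case: pselect => // p; case: pselect.
Qed.

Lemma sect_val_surj U a : (U : set _) !=set0 ->
  (forall x, opens_set U x -> subring_set (zariski_ring x) a) ->
  exists s : F U, sect_val s = a.
Proof.
rewrite /sect_val /= /zariski_sect; case: pselect => // p _ Ua.
by exists (exist _ a (mem_set Ua)).
Qed.

Lemma sect_val1 U : (U : set _) !=set0 -> sect_val (1 : F U) = 1.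
Proof. by rewrite /sect_val /= /zariski_sect; case: pselect. Qed.

Lemma sect_val0 U : sect_val (0 : F U) = 0.
Proof. by rewrite /sect_val /= /zariski_sect; case: pselect. Qed.

Lemma sect_valD U (s t : F U) : sect_val (s + t) = sect_val s + sect_val t.
Proof.
move: s t; rewrite /sect_val /= /zariski_sect; case: pselect => // p s t.
by rewrite addr0.
Qed.

Lemma sect_valM U (s t : F U) : sect_val (s * t) = sect_val s * sect_val t.
Proof.
move: s t; rewrite /sect_val /= /zariski_sect; case: pselect => // p s t.
by rewrite mulr0.
Qed.

Lemma zariski_integral : [set: zariski_space X] !=set0 -> integral F.
Proof.
move=> X0; split=> // U Un; split.
  move=> /(congr1 (@sect_val U)); rewrite sect_val1 // sect_val0.
  by apply/eqP; exact: oner_neq0.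
move=> s t /(congr1 (@sect_val U)); rewrite sect_valM sect_val0 => /eqP.
rewrite mulf_eq0 => /orP[]/eqP st0; [left|right];
  by apply: (sect_val_inj Un); rewrite sect_val0.
Qed.

Section Generic.
Variables (eta : zariski_space X) (etaT : zariski_ring eta = full_subring K).

Lemma generic_in U : (U : set _) !=set0 -> opens_set U eta.
Proof.
move=> [x Ux]; have [H [_ _]] := open_zariski_nbhd (opensP U) Ux.
by apply; rewrite /zariski_basis /= etaT.
Qed.

(** Nonempty members of the cover meet at [eta], so compatible sections have one common value in K;
    it lies in each ring of [U] because the cover reaches every point. *)
Lemma zariski_sheaf : sheaf F.
Proof.
move=> I U V VU cov s compat.
have [Un|Un] := pselect ((U : set _) !=set0); last first.
  have Ve i : ~ ((V i : set _) !=set0) by move=> /(subset_nonempty (VU i)).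
  by exists 0; split=> [i|t _]; exact: sect_empty.
have [i0 _ Vi0] := cov eta (generic_in Un).
have Vn0 : (V i0 : set _) !=set0 by exists eta.
have same i : (V i : set _) !=set0 -> sect_val (s i) = sect_val (s i0).
  move=> Vn; have Vi := generic_in Vn.
  have In : (opensI (V i) (V i0) : set _) !=set0 by exists eta.
  by have := congr1 (@sect_val _) (compat i i0); rewrite !sect_val_res.
have [|t et] := @sect_val_surj U (sect_val (s i0)) Un.
  move=> x /cov[i _ Vix]; rewrite -(same i); last by exists x.
  exact: sect_valP.
exists t; split=> [i|t' ht'].
  have [Vn|Vn] := pselect ((V i : set _) !=set0); last exact: sect_empty.
  by apply: (sect_val_inj Vn); rewrite sect_val_res // et same.
by apply: (sect_val_inj Un); rewrite et -(ht' i0) sect_val_res.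
Qed.

Section Stalk.
Variable x : zariski_space X.

Definition germ_val (g : germ F x) : K := sect_val (germ_sect g).

Lemma germ_valP (g h : germ F x) : germ_eqv g h <-> germ_val g = germ_val h.
Proof.
split=> [[W [Wg [Wh [Wx e]]]]|e].
  have Wn : (W : set _) !=set0 by exists x.
  by rewrite /germ_val -(sect_val_res Wg _ Wn) e sect_val_res.
exists (opensI (germ_dom g) (germ_dom h)), (@opensIl _ _ _), (@opensIr _ _ _).
have In : (opensI (germ_dom g) (germ_dom h) : set _) !=set0.
  by exists x; split; exact: germ_in.
split; first by split; exact: germ_in.
by apply: (sect_val_inj In); rewrite !sect_val_res.
Qed.

Definition stalk_val (q : stalk F x) : K := germ_val (quot_repr q).

Lemma stalk_valE (g : germ F x) :
  stalk_val (@to_quot (stalk_setoid F x) g) = germ_val g.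
Proof. exact/germ_valP/(@sr_eqv_repr (stalk_setoid F x) g). Qed.

Lemma stalk_local : local (zariski_ring x) -> local [set: stalk F x].
Proof.
move=> lR; apply: (@local_embedding _ _ (stalk F x) stalk_val lR).
- elim/quot_ind => g; elim/quot_ind => h; rewrite !stalk_valE => /germ_valP e.
  exact/to_quotP.
- rewrite [LHS]stalk_valE /germ_val /= sect_val1 //.
  by exists x.
- move=> p q; rewrite [LHS]stalk_valE /germ_val /= sect_valD !sect_val_res //.
    by exists x; split; exact: germ_in.
  by exists x; split; exact: germ_in.
- move=> p q; rewrite [LHS]stalk_valE /germ_val /= sect_valM !sect_val_res //.
    by exists x; split; exact: germ_in.
  by exists x; split; exact: germ_in.
- elim/quot_ind => g; rewrite stalk_valE; apply: sect_valP; exact: germ_in.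
(* An element r of the local ring is a section over the basic open set of all rings containing r. *)
- move=> r xr; pose U := Opens (open_zariski_basis X (finite_set1 r)).
  have Ux : opens_set U x by move=> _ ->.
  have [||s sr] := @sect_val_surj U r.
  + by exists x.
  + by move=> y; apply.
  + by exists (@to_quot (stalk_setoid F x) (Germ Ux s)); rewrite stalk_valE.
Qed.

End Stalk.

End Generic.
End Sections.

(** * The isomorphism of an affine patch with a spectrum *)

Lemma Spec_eq (A : comPzRingType) (p q : Spec A) :
  spec_prime p = spec_prime q -> p = q.
Proof.
case: p q => [P hP] [Q hQ] /= PQ; rewrite PQ in hP *.
by rewrite (Prop_irrelevance hP hQ).
Qed.

(** * Sections of the spectrum of a subring as elements of K *)

Section SubringSpec.
Variables (K : fieldType) (A : subring K).
Local Notation AT := (subring_type A).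
Implicit Types (p q : Spec AT) (U V W : opens (Spec AT)).

Definition in_subring (a : K) (Aa : subring_set A a) : AT := exist _ a (mem_set Aa).

Lemma subring_type_val (a : AT) : subring_set A (val a).
Proof. exact: set_mem (valP a). Qed.

Definition prime_image p : set K := [set val a | a in spec_prime p].

Lemma prime_image_val p (a : AT) : prime_image p (val a) <-> spec_prime p a.
Proof.
by split=> [[b pb /val_inj <-]|pa]; [|exists a].
Qed.

Lemma prime_imageP p : prime_ideal A (prime_image p).
Proof.
have [[_ p0 pD pM] p1 pP] := spec_primeP p.
split; first split.
- by move=> _ [a _ <-]; exact: subring_type_val.
- by exists 0.
- by move=> _ _ [a pa <-] [b pb <-]; exists (a + b); [exact: pD|].
- by move=> a _ Aa [b pb <-]; exists (in_subring Aa * b); [exact: pM|].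
- by move=> /(prime_image_val p 1).
- move=> a b Aa Ab /(prime_image_val p (in_subring Aa * in_subring Ab)).
  by move=> /pP[//|//|pa|pb]; [left|right];
    [exists (in_subring Aa)|exists (in_subring Ab)].
Qed.

Definition prime_loc p : subring K := loc (prime_imageP p).

Lemma den_neq0 p (f : AT) : ~ spec_prime p f -> val f != 0.
Proof.
by move=> pf; apply: (prime_neq0 (prime_imageP p)) => /prime_image_val.
Qed.

Definition frac_val p (z : Defs.frac p) : K := val (num z) / val (den z).

Lemma frac_valP p (z w : Defs.frac p) : frac_eqv z w <-> frac_val z = frac_val w.
Proof.
have z0 := den_neq0 (@denP _ _ z); have w0 := den_neq0 (@denP _ _ w).
rewrite /frac_val; split=> [[u pu e]|e].
  apply/eqP; rewrite eqr_div //; apply/eqP.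
  by apply: (mulfI (den_neq0 pu)); exact: (congr1 val e).
apply: frac_eqv1; apply: val_inj => /=.
by move/eqP: e; rewrite eqr_div // => /eqP.
Qed.

Definition loc_val p (z : localization p) : K := frac_val (quot_repr z).

Lemma loc_valE p (a f : AT) (pf : ~ spec_prime p f) :
  loc_val (to_localization a pf) = val a / val f.
Proof. exact/(frac_valP _ (Frac a pf))/(@sr_eqv_repr (localization_setoid p)). Qed.

Lemma loc_val_quot p (z : Defs.frac p) :
  loc_val (@to_quot (localization_setoid p) z) = frac_val z.
Proof. exact/frac_valP/(@sr_eqv_repr (localization_setoid p)). Qed.

Lemma loc_val_inj p : injective (@loc_val p).
Proof.
elim/quot_ind => z; elim/quot_ind => w; rewrite !loc_val_quot => /frac_valP e.
exact/to_quotP.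
Qed.

Lemma loc_valD p : {morph @loc_val p : z w / z + w}.
Proof.
move=> z w; rewrite [LHS]loc_val_quot /loc_val /frac_val /= addf_div //;
  exact: den_neq0 (@denP _ _ _).
Qed.

Lemma loc_valM p : {morph @loc_val p : z w / z * w}.
Proof. by move=> z w; rewrite [LHS]loc_val_quot /loc_val /frac_val /= mulf_div. Qed.

Lemma loc_val1 p : loc_val (1 : localization p) = 1.
Proof. by rewrite [LHS]loc_val_quot /frac_val /= divr1. Qed.

Lemma loc_val_mem p (z : localization p) : subring_set (prime_loc p) (loc_val z).
Proof.
rewrite /loc_val /frac_val; case: (quot_repr z) => a f pf /=.
exists (val a), (val f); split=> //; try exact: subring_type_val.
by move/prime_image_val.
Qed.

Lemma zero_primeS : prime_ideal [set: AT] [set 0].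
Proof.
split; first split=> //.
- by move=> _ _ -> ->; rewrite addr0.
- by move=> a _ _ ->; rewrite mulr0.
- by move=> /(congr1 val) /eqP; rewrite oner_eq0.
- move=> a b _ _ /(congr1 val) /eqP; rewrite mulf_eq0.
  by move=> /orP[]/eqP h; [left|right]; exact: val_inj.
Qed.

Definition spec_generic : Spec AT := SpecPoint zero_primeS.

Lemma spec_generic_in V p : opens_set V p -> opens_set V spec_generic.
Proof.
have [E ->] := opensP V => /spec_nonvanishingP[a Ea pa].
apply/spec_nonvanishingP; exists a => // a0; apply: pa; rewrite a0.
by have [[]] := spec_primeP p.
Qed.

(** The value is read at the zero ideal, which lies in every nonempty open set; 0 is the default for
    empty [V]. *)
Definition spec_val V (s : spec_section V) : K :=
  match pselect (opens_set V spec_generic) with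
  | left h => loc_val (section_family s h)
  | right _ => 0
  end.

(** Near [p] the section is a single fraction, and that neighbourhood also contains the zero ideal,
    where the same fraction is read. *)
Lemma spec_valE V (s : spec_section V) p (Vp : opens_set V p) :
  loc_val (section_family s Vp) = spec_val s.
Proof.
rewrite /spec_val; case: pselect => [V0|V0]; last by case: V0; exact: spec_generic_in Vp.
have /asboolP hs := section_familyP s.
have [W [Wp WV [a [f h]]]] := hs p Vp.
have [pf ->] := h p Vp Wp.
have [gf ->] := h _ V0 (spec_generic_in Wp).
by rewrite !loc_valE.
Qed.

Lemma spec_val_inj V p : opens_set V p -> injective (@spec_val V).
Proof.
move=> Vp s t e; apply: val_inj; apply: family_ext => q Vq.
by apply: loc_val_inj; rewrite !spec_valE.
Qed.

Lemma spec_val_res U V (VU : V `<=` U) (s : spec_section U) p :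
  opens_set V p -> spec_val (spec_res VU s) = spec_val s.
Proof. by move=> Vp; rewrite -(spec_valE _ Vp) -(spec_valE s (VU _ Vp)). Qed.

Lemma spec_val1 V p : opens_set V p -> spec_val (1 : spec_section V) = 1.
Proof. by move=> Vp; rewrite -(spec_valE _ Vp); exact: loc_val1. Qed.

Lemma spec_valD V p : opens_set V p -> {morph @spec_val V : s t / s + t}.
Proof. by move=> Vp s t; rewrite -!(spec_valE _ Vp); exact: loc_valD. Qed.

Lemma spec_valM V p : opens_set V p -> {morph @spec_val V : s t / s * t}.
Proof. by move=> Vp s t; rewrite -!(spec_valE _ Vp); exact: loc_valM. Qed.

Lemma spec_val_mem V p (s : spec_section V) : opens_set V p ->
  subring_set (prime_loc p) (spec_val s).
Proof. by move=> Vp; rewrite -(spec_valE _ Vp); exact: loc_val_mem. Qed.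

Lemma prime_loc_frac p x : subring_set (prime_loc p) x ->
  exists (a f : AT), ~ spec_prime p f /\ x = val a / val f.
Proof.
move=> [a [f [Aa Af pf ->]]]; exists (in_subring Aa), (in_subring Af).
by split=> // /(prime_image_val p (in_subring Af)).
Qed.

Lemma spec_val_surj V x : (exists p, opens_set V p) ->
  (forall p, opens_set V p -> subring_set (prime_loc p) x) ->
  exists s : spec_section V, spec_val s = x.
Proof.
move=> [p0 Vp0] hx.
have ex p (Vp : opens_set V p) : exists z : localization p, loc_val z = x.
  have [a [f [pf ->]]] := prime_loc_frac (hx p Vp).
  by exists (to_localization a pf); rewrite loc_valE.
pose s : spec_family V := fun p Vp => projT1 (cid (ex p Vp)).
have sE p Vp : loc_val (s p Vp) = x by rewrite /s; case: cid.
have hs : s \in @spec_sections AT V.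
  apply/asboolP => p Vp; have [a [f [pf xaf]]] := prime_loc_frac (hx p Vp).
  (* A denominator f valid at [p] is valid on all of D(f), so the family of constant value x is
     locally the single fraction a/f. *)
  have oD : open (spec_nonvanishing [set f]) by exists [set f].
  exists (opensI V (Opens oD)); split.
  - by split=> //; apply/spec_nonvanishingP; exists f.
  - exact: opensIl.
  - exists a, f => q Vq [_ /spec_nonvanishingP[_ -> qf]]; exists qf.
    by apply: loc_val_inj; rewrite sE loc_valE.
by exists (SpecSection hs); rewrite -(spec_valE _ Vp0).
Qed.

End SubringSpec.

(** * Mutually inverse maps: center on A and localization of A *)

Section AffineIso.
Variables (K : fieldType) (X : set (subring K)) (locX : forall R, X R -> local R).
Variables (A : subring K) (patchA : affine_patch X A).
Variables (U : opens (zariski_space X)) (UA : opens_set U = overrings A).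
Local Notation AT := (subring_type A).
Local Notation T := (set_type U).
Implicit Types (x : T) (p : Spec AT).

Lemma patch_over x : overrings A (set_val x).
Proof. by rewrite -UA; exact: set_valP. Qed.

Definition center x : set AT := [set a | nonunits (zariski_ring (set_val x)) (val a)].

Lemma center_prime x : prime_ideal setT (center x).
Proof.
have [[_ N0 ND NM] N1 NP] := local_nonunits_prime (locX (zariski_ringP (set_val x))).
have Ax (a : AT) : subring_set (zariski_ring (set_val x)) (val a).
  by apply: patch_over; exact: subring_type_val.
split; first split=> //.
- by move=> a b; exact: ND.
- by move=> a b _; exact: NM.
- exact: N1.
- by move=> a b _ _; exact: NP.
Qed.

Definition patch_spec x : Spec AT := SpecPoint (center_prime x).

Lemma prime_loc_patch p : X (prime_loc p) /\ A `<=` prime_loc p.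
Proof.
by apply/patchA/localizationsP; exists (prime_image p), (prime_imageP p).
Qed.

Definition loc_point p : zariski_space X := SigSub (mem_set (prime_loc_patch p).1).

Lemma loc_point_over p : opens_set U (loc_point p).
Proof. by rewrite UA; exact: (prime_loc_patch p).2. Qed.

Definition spec_patch p : T := SigSub (mem_set (loc_point_over p)).

Lemma center_image x P (hP : prime_ideal A P) :
  zariski_ring (set_val x) = loc hP -> prime_image (patch_spec x) = P.
Proof.
move=> ex; apply/seteqP; split=> [_ [a ha <-]|a Pa].
  by move: ha; rewrite /= /center /= ex => /(loc_nonunits hP (subring_type_val a)).
have Aa : subring_set A a by have [[h _ _ _] _ _] := hP; exact: h.
by exists (in_subring Aa) => //; rewrite /= /center /= ex; exact/loc_nonunits.
Qed.

Lemma zariski_ring_patch x :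
  zariski_ring (set_val x) = prime_loc (patch_spec x).
Proof.
have /localizationsP[P [hP ex]] : localizations A (zariski_ring (set_val x)).
  by apply/patchA; split; [exact: zariski_ringP|exact: patch_over].
by rewrite ex; apply: subring_eq; rewrite /= (center_image ex).
Qed.

Lemma patch_specK : cancel patch_spec spec_patch.
Proof.
move=> x; apply: val_inj; apply: val_inj.
by rewrite /= -zariski_ring_patch.
Qed.

Lemma spec_patchK : cancel spec_patch patch_spec.
Proof.
move=> p; apply: Spec_eq; apply/seteqP; split=> a /=.
  move=> /(loc_nonunits (prime_imageP p) (subring_type_val a)).
  by move/prime_image_val.
by move=> pa; apply/(loc_nonunits (prime_imageP p) (subring_type_val a))/prime_image_val.
Qed.

Lemma unit_locus_patch x (a : AT) :
  unit_locus A (val a) (set_val x) <-> ~ spec_prime (patch_spec x) a.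
Proof.
rewrite (loc_unit_locus (zariski_ring_patch x) (subring_type_val a)).
by rewrite prime_image_val.
Qed.

Lemma patch_spec_continuous : continuous patch_spec.
Proof.
apply/continuousP => _ [E ->].
exists (\bigcup_(a in E) unit_locus A (val a)).
  by apply: bigcup_open => a _; apply: open_unit_locus; rewrite -UA; exact: opensP.
apply/seteqP; split=> x.
  by move=> [a Ea /unit_locus_patch ha]; apply/spec_nonvanishingP; exists a.
by move=> /spec_nonvanishingP[a Ea /unit_locus_patch ha]; exists a.
Qed.

Lemma spec_patch_continuous : continuous spec_patch.
Proof.
apply/continuousP => _ [W oW <-].
(* The witness is the largest possible one: all s whose principal open set is contained in the
   preimage of [W]. *)
exists [set s | forall q, ~ spec_prime q s -> W (set_val (spec_patch q))].
apply/seteqP; split=> p; last by move=> /spec_nonvanishingP[s hs /hs].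
move=> Wp; apply/spec_nonvanishingP.
have [s [As ps sW]] := unit_locus_nbhd patchA oW Wp (patch_over _).
have spec q : unit_locus A s (set_val (spec_patch q)) <->
    ~ spec_prime q (in_subring As).
  by rewrite (unit_locus_patch _ (in_subring As)) spec_patchK.
exists (in_subring As); last exact/spec.
by move=> q /spec; exact: sW.
Qed.

Local Notation F := (presheaf_restrict (zariski_presheaf X) U).
Local Notation pre V := (opens_preimage patch_spec_continuous V).
Implicit Types V : opens (Spec AT).

Definition sect_of V (t : F (pre V)) : K := @sect_val K X (opens_image (pre V)) t.

Lemma pre_nonempty V p : opens_set V p -> (opens_image (pre V) : set _) !=set0.
Proof.
move=> Vp; exists (set_val (spec_patch p)), (spec_patch p) => //=.
by rewrite spec_patchK.
Qed.

Lemma pre_point V y : opens_set (opens_image (pre V)) y ->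
  exists2 p, opens_set V p & zariski_ring y = prime_loc p.
Proof.
by move=> [x Vx <-]; exists (patch_spec x) => //; exact: zariski_ring_patch.
Qed.

(** Quantifying over the points of [V] lets one statement also cover empty [V], where the condition
    is vacuous and the target is the zero ring. *)
Lemma sect_map_ex V (s : spec_section V) : exists t : F (pre V),
  forall p, opens_set V p -> sect_of t = spec_val s.
Proof.
have [[y Vy]|Vn] := pselect ((opens_image (pre V) : set _) !=set0); last first.
  by exists 0 => p /pre_nonempty.
have [||t st] := @sect_val_surj K X (opens_image (pre V)) (spec_val s).
- by exists y.
- by move=> z /pre_point[p Vp ->]; exact: spec_val_mem.
- by exists t.
Qed.

Definition sect_map V (s : spec_section V) : F (pre V) := projT1 (cid (sect_map_ex s)).

Lemma sect_mapE V (s : spec_section V) p :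
  opens_set V p -> sect_of (sect_map s) = spec_val s.
Proof. by rewrite /sect_map; case: cid => t /= h; exact: h. Qed.

Lemma sect_of_eq V (t t' : F (pre V)) :
  (forall p, opens_set V p -> sect_of t = sect_of t') -> t = t'.
Proof.
move=> h; have [Vn|Vn] := pselect ((opens_image (pre V) : set _) !=set0).
  apply: (sect_val_inj Vn); have [y /pre_point[p Vp _]] := Vn.
  exact: h Vp.
exact: sect_empty.
Qed.

Lemma sect_map_zmod V : zmod_morphism (@sect_map V).
Proof.
(* Values are known to respect sums, so the subtraction is first turned into an addition. *)
move=> s t; apply: (@addIr _ (sect_map t)); rewrite subrK.
apply: sect_of_eq => p Vp; rewrite [LHS]sect_valD.
have e := sect_mapE _ Vp; rewrite /sect_of in e *; rewrite !e.
by rewrite -(spec_valD Vp) subrK.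
Qed.

Lemma sect_map_monoid V : monoid_morphism (@sect_map V).
Proof.
split=> [|s t]; apply: sect_of_eq => p Vp; rewrite (sect_mapE _ Vp).
  by rewrite (spec_val1 Vp) [RHS]sect_val1 //; exact: pre_nonempty Vp.
rewrite (spec_valM Vp) [RHS]sect_valM.
have e := sect_mapE _ Vp; rewrite /sect_of in e *; by rewrite !e.
Qed.

HB.instance Definition _ V := GRing.isZmodMorphism.Build
  (spec_section V) (F (pre V)) (@sect_map V) (@sect_map_zmod V).
HB.instance Definition _ V := GRing.isMonoidMorphism.Build
  (spec_section V) (F (pre V)) (@sect_map V) (@sect_map_monoid V).

Lemma sect_map_bij V : bijective (@sect_map V).
Proof.
have surj (t : F (pre V)) : exists s, sect_map s = t.
  have [[p Vp]|Vn] := pselect (exists p, opens_set V p); last first.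
    by exists 0; apply: sect_of_eq => p Vp; case: Vn; exists p.
  have [||s es] := @spec_val_surj K A V (sect_of t).
  - by exists p.
  - move=> q Vq; have -> : prime_loc q = zariski_ring (set_val (spec_patch q)) by [].
    by apply: sect_valP; exists (spec_patch q) => //=; rewrite spec_patchK.
  - by exists s; apply: sect_of_eq => q Vq; rewrite (sect_mapE _ Vq).
have inj : injective (@sect_map V).
  move=> s t st; have [[p Vp]|Vn] := pselect (exists p, opens_set V p).
    by apply: (spec_val_inj Vp); rewrite -!(sect_mapE _ Vp) st.
  by apply: val_inj; apply: family_ext => p Vp; case: Vn; exists p.
pose g t := projT1 (cid (surj t)).
have gK : cancel g (@sect_map V) by move=> t; rewrite /g; case: cid.
by exists g => // s; apply: inj; rewrite gK.
Qed.

Lemma patch_affine : affine F.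
Proof.
exists AT; constructor.
apply: (@RingedIso _ _ F (spec_presheaf AT) patch_spec spec_patch patch_specK
  spec_patchK patch_spec_continuous spec_patch_continuous (fun V => @sect_map V)).
- move=> V W WV s; apply: sect_of_eq => p Wp.
  rewrite (sect_mapE _ Wp) [LHS](spec_val_res WV s Wp).
  rewrite /sect_of /= sect_val_res; last exact: pre_nonempty Wp.
  by rewrite -(sect_mapE s (WV _ Wp)).
- exact: sect_map_bij.
Qed.

End AffineIso.

(** The localization of some [E i] at zero is a member of [X], so it has fraction field K; being a
    field, it is K. *)
Lemma model_generic_point (K : fieldType) (D : subring K) (X : set (subring K)) :
  model D X -> exists eta : zariski_space X, zariski_ring eta = full_subring K.
Proof.
move=> hX; have [[[R XR] XL] _ _] := hX.
have [n [E [patchE _ coverE]]] := model_affine_cover hX.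
have [i _] := coverE (SigSub (mem_set XR)).
have [XL0 _] : X (loc (zero_prime (E i))) /\ E i `<=` loc (zero_prime (E i)).
  by apply/patchE/localizationsP; exists [set 0], (zero_prime (E i)).
exists (SigSub (mem_set XL0)); apply: loc_zero_full.
by have [] := XL _ XL0.
Qed.

Theorem proposition2p3 (K : fieldType) (D : subring K) (X : set (subring K))
    (hX : model D X) :
  [/\ scheme (zariski_presheaf X),
      quasi_compact (zariski_space X),
      quasi_separated (zariski_space X)
    & integral (zariski_presheaf X)].
Proof.
have [[_ XL] irrX _] := hX.
have locX R : X R -> local R by move=> /XL[].
have [n [E [patchE openE coverE]]] := model_affine_cover hX.
have [eta etaT] := model_generic_point hX.
split.
- split.
    split; first exact: zariski_sheaf etaT.
    by move=> x; apply: stalk_local; apply: locX; exact: zariski_ringP.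
  move=> x; have [i Ex] := coverE x.
  by exists (Opens (openE i)) => //; exact: (patch_affine locX (patchE i)).
- exact: zariski_quasi_compact coverE.
- exact: zariski_quasi_separated coverE.
- by apply: zariski_integral; exists eta.
Qed.
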